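(* Let $d=3$ and let $\mathbf{u}\in C^1([0,T);V^m)$, $m\ge1$, be a strong solution of the Euler equations on $\mathbb{\Lambda}^3$. Let $\mathbf{h}\in C^1([0,T);V^m)$ be a divergence-free field satisfying $\partial_t\mathbf{h}+\mathbf{u}\ast\nabla\mathbf{h}-\mathbf{h}\ast\nabla\mathbf{u}=\mathbf{0}$ for all $\mathbf{k}\neq\mathbf{0}$ and $t\in[0,T)$. Then the cross-correlation $\Gamma(t)=(\mathbf{u},\mathbf{h})$ is constant in $t\in[0,T)$.
   Context: Let $\lambda$ be one of: $2$; the plastic number $\sigma$ (unique real root of $x^3-x-1=0$); or $\lambda>1$ with $\lambda^b-\lambda^a=1$ for mutually prime integers $0\le a<b\le62$, $(a,b)\notin\{(1,3),(4,5)\}$. Let $\mathbb{\Lambda}=\{0\}\cup\{\pm\lambda^n:n=0,1,2,\dots\}$. Fields on $\mathbb{\Lambda}^3$ satisfy $f(-\mathbf{k})=\overline{f(\mathbf{k})}$. Derivatives $(\partial_jf)(\mathbf{k})=ik_jf(\mathbf{k})$, $(\nabla p)(\mathbf{k})=i\mathbf{k}p(\mathbf{k})$, $(\nabla\cdot\mathbf{u})(\mathbf{k})=i\mathbf{k}\cdot\mathbf{u}(\mathbf{k})$. Inner product $(\mathbf{u},\mathbf{h})=\sum_{\mathbf{k}}\sum_i u_i(\mathbf{k})\overline{h_i(\mathbf{k})}$. Product $(f\ast g)(\mathbf{k})=\sum_{\mathbf{p}+\mathbf{q}=\mathbf{k},\,\mathbf{p},\mathbf{q}\in\mathbb{\Lambda}^3}f(\mathbf{p})g(\mathbf{q})$;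 $(\mathbf{a}\ast\nabla\mathbf{b})_i=\sum_j a_j\ast\partial_jb_i$. For integer $m\ge0$, $\|\mathbf{u}\|_{h^m}^2=\sum_{\mathbf{k}\neq\mathbf{0}}|\mathbf{k}|^{2m}|\mathbf{u}(\mathbf{k})|^2$; $V^m$ is the space of fields with $\mathbf{u}(\mathbf{0})=\mathbf{0}$, $\nabla\cdot\mathbf{u}=0$ and finite $h^m$ norm. A strong solution of the Euler equations on $[0,T)$ is $\mathbf{u}\in C^1([0,T);V^m)$ together with a scalar field $p(\cdot,t)$ such that $\partial_t\mathbf{u}+\mathbf{u}\ast\nabla\mathbf{u}=-\nabla p$ holds for all $\mathbf{k}\neq\mathbf{0}$ and $t\in[0,T)$. *)

(* Defs.v *)
(* (MathComp-Analysis over an abstract R : realType,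
   complex numbers R[i] from mathcomp-real-closed). *)
From HB Require Import structures.
From mathcomp Require Import all_boot all_order all_algebra.
From mathcomp Require Import all_classical all_reals.
From mathcomp Require Import topology normedtype ereal esum.
From mathcomp Require Import complex.
Set Implicit Arguments. Unset Strict Implicit. Unset Printing Implicit Defensive.
Import Order.TTheory GRing.Theory Num.Theory.
Import numFieldTopology.Exports numFieldNormedType.Exports.
Local Open Scope classical_set_scope.
Local Open Scope ring_scope.
Local Open Scope complex_scope.

Section LogLattice.
Variable R : realType.
Local Notation C := R[i].

(* admissible spacing parameters lambda *)
Definition lambda_ok (l : R) : Prop :=
  l = 2
  \/ l ^+ 3 - l - 1 = 0  (* plastic number: unique real root of x^3-x-1 *)
  \/ (exists a b : nat, [/\ (a < b <= 62)%N, coprime a b,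
        (a, b) <> (1%N, 3%N), (a, b) <> (4%N, 5%N) & 1 < l /\ l ^+ b - l ^+ a = 1]).

(* the one-dimensional log-lattice Lambda = {0} U {+- l^n : n >= 0} *)
Definition Lam (l : R) : set R :=
  [set x | x = 0 \/ exists n : nat, x = l ^+ n \/ x = - l ^+ n].

(* wave vectors are row vectors 'rV[R]_3; Lambda^3 *)
Definition Lam3 (l : R) : set 'rV[R]_3 := [set k | forall j, Lam l (k ord0 j)].

(* real-valued unordered sum over a set (positive part minus negative part) *)
Definition rsum (T : choiceType) (D : set T) (g : T -> R) : R :=
  fine (\esum_(x in D) (Num.max (g x) 0)%:E)
  - fine (\esum_(x in D) (Num.max (- g x) 0)%:E).

(* complex-valued unordered sum over a set *)
Definition csum (T : choiceType) (D : set T) (f : T -> C) : C :=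
  (rsum D (fun x => complex.Re (f x))) +i* (rsum D (fun x => complex.Im (f x))).

(* squared modulus of a complex number, as a real *)
Definition cabs2 (z : C) : R := complex.Re z ^+ 2 + complex.Im z ^+ 2.

(* scalar fields: 'rV[R]_3 -> C ; vector fields: 'rV[R]_3 -> 'rV[C]_3 *)

(* reality condition f(-k) = conj (f k) *)
Definition real_sfield (l : R) (f : 'rV[R]_3 -> C) : Prop :=
  forall k, Lam3 l k -> f (- k) = (f k)^*.
Definition real_vfield (l : R) (u : 'rV[R]_3 -> 'rV[C]_3) : Prop :=
  forall k, Lam3 l k -> forall i, u (- k) ord0 i = (u k ord0 i)^*.

(* product (convolution) (f * g)(k) = sum_{p+q=k, p,q in Lambda^3} f(p) g(q) *)
Definition conv (l : R) (f g : 'rV[R]_3 -> C) (k : 'rV[R]_3) : C :=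
  csum [set pq : 'rV[R]_3 * 'rV[R]_3 | [/\ Lam3 l pq.1, Lam3 l pq.2 & pq.1 + pq.2 = k]]
       (fun pq => f pq.1 * g pq.2).

(* partial derivative (d_j f)(k) = i k_j f(k) *)
Definition pd (j : 'I_3) (f : 'rV[R]_3 -> C) : 'rV[R]_3 -> C :=
  fun k => 'i * (k ord0 j)%:C * f k.

(* (a * grad b)_i = sum_j a_j * d_j b_i *)
Definition adv (l : R) (a b : 'rV[R]_3 -> 'rV[C]_3) (k : 'rV[R]_3) : 'rV[C]_3 :=
  \row_(i < 3) \sum_(j < 3) conv l (fun p => a p ord0 j) (pd j (fun q => b q ord0 i)) k.

(* gradient of a scalar field *)
Definition grad (p : 'rV[R]_3 -> C) (k : 'rV[R]_3) : 'rV[C]_3 :=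
  \row_(j < 3) ('i * (k ord0 j)%:C * p k).

(* divergence *)
Definition div (u : 'rV[R]_3 -> 'rV[C]_3) (k : 'rV[R]_3) : C :=
  \sum_(j < 3) 'i * (k ord0 j)%:C * u k ord0 j.

(* squared h^m norm: sum_{k <> 0} |k|^{2m} |u(k)|^2 (extended real) *)
Definition hm_sq (l : R) (m : nat) (u : 'rV[R]_3 -> 'rV[C]_3) : \bar R :=
  \esum_(k in [set k | Lam3 l k /\ k != 0])
     (((\sum_(j < 3) k ord0 j ^+ 2) ^+ m * \sum_(i < 3) cabs2 (u k ord0 i))%:E).

(* the space V^m *)
Definition inV (l : R) (m : nat) (u : 'rV[R]_3 -> 'rV[C]_3) : Prop :=
  [/\ real_vfield l u, u 0 = 0, (forall k, Lam3 l k -> div u k = 0)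
    & (hm_sq l m u < +oo)%E].

(* inner product (u, h) = sum_k sum_i u_i(k) conj(h_i(k)) *)
Definition inner (l : R) (u h : 'rV[R]_3 -> 'rV[C]_3) : C :=
  csum (Lam3 l) (fun k => \sum_(i < 3) u k ord0 i * (h k ord0 i)^*).

(* the time interval [0, T), T possibly +oo *)
Definition inI (T : \bar R) (t : R) : Prop := 0 <= t /\ (t%:E < T)%E.

(* u in C^1([0,T); V^m) with time derivative u' (derivative and continuity
   taken in the h^m norm) *)
Definition C1V (l : R) (m : nat) (T : \bar R)
    (u u' : R -> 'rV[R]_3 -> 'rV[C]_3) : Prop :=
  [/\ forall t, inI T t -> inV l m (u t) /\ inV l m (u' t),
      forall t, inI T t ->
        (fun s => hm_sq l m (fun k => (s^-1)%:C *: (u (t + s) k - u t k) - u' t k))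
          @ within [set s | s != 0 /\ inI T (t + s)] (nbhs (0 : R)) --> 0%E
    & forall t, inI T t ->
        (fun s => hm_sq l m (fun k => u' s k - u' t k))
          @ within (inI T) (nbhs t) --> 0%E].

(* strong solution of the Euler equations on [0,T) *)
Definition euler_strong (l : R) (m : nat) (T : \bar R)
    (u u' : R -> 'rV[R]_3 -> 'rV[C]_3) : Prop :=
  C1V l m T u u' /\
  exists p : R -> 'rV[R]_3 -> C,
    (forall t, inI T t -> real_sfield l (p t)) /\
    (forall t, inI T t -> forall k, Lam3 l k -> k != 0 ->
       u' t k + adv l (u t) (u t) k = - grad (p t) k).

End LogLattice.

(* Main.v *)
(* On the wave vectors [k = p + q] of the log-lattice the formal derivative of the
   cross-correlation is a sum of the terms [a_j(p) i q_j b_i(q) conj (c_i(k))], and it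
   vanishes because the involution [(k, p, q) -> (q, - p, k)] is an integration by parts: it
   changes the sign and exchanges [b] and [c]; the pressure drops out since [div h = 0].
   What needs proof is that these sums converge absolutely and may be rearranged. In
   dimension one, since [l > 1], the equation [p + q = k] with [k != 0] forces [p / k] into
   a finite set, so the trilinear form carried by the triads is a finite sum of forms, each
   of which is bounded on [l^2 * l^2 * l^2] because two of the three entries of a triad
   determine it; boundedness passes to products of index sets, hence to dimension three.
   The field that is differentiated is in [l^2] with one derivative because [m >= 1], and
   the C^1 hypothesis makes the derivative of the cross-correlation the formal one. *)
Require Import Defs.
From HB Require Import structures.
From mathcomp Require Import all_boot all_order all_algebra.
From mathcomp Require Import all_classical all_reals.
From mathcomp Require Import topology normedtype ereal esum.
From mathcomp Require Import complex.
From mathcomp Require Import realfun derive.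
From mathcomp Require Import ring lra.
Import Order.TTheory GRing.Theory Num.Theory.
Import numFieldTopology.Exports numFieldNormedType.Exports.
Local Open Scope classical_set_scope.
Local Open Scope ring_scope.
Local Open Scope complex_scope.

Set Implicit Arguments. Unset Strict Implicit. Unset Printing Implicit Defensive.

Local Notation rsummable D f := (summable D (fun x => (f x)%:E)).

(** * Unordered sums *)

Section RealSums.
Variable R : realType.

Lemma esum_le_bij (I J : choiceType) (S : set I) (D : set J) (e : I -> J)
    (f : J -> \bar R) :
  set_inj S e -> (forall i, S i -> D (e i)) -> (forall j, D j -> (0 <= f j)%E) ->
  (\esum_(i in S) f (e i) <= \esum_(j in D) f j)%E.
Proof.
move=> einj eD f0; rewrite -esum_image//.
have sub : e @` S `<=` D by move=> _ [i Si <-]; exact: eD.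
rewrite (esumID (e @` S) D)// setIidr//.
by rewrite leeDl// esum_ge0// => j [/f0].
Qed.

Lemma esumZl (I : choiceType) (D : set I) (c : R) (f : I -> \bar R) :
  0 <= c -> (forall x, (0 <= f x)%E) ->
  (\esum_(x in D) (c%:E * f x) = c%:E * \esum_(x in D) f x)%E.
Proof.
move=> c0 f0.
have le d (g : I -> \bar R) : 0 <= d -> (forall x, (0 <= g x)%E) ->
    (\esum_(x in D) (d%:E * g x) <= d%:E * \esum_(x in D) g x)%E.
  move=> d0 g0; apply: ge_ereal_sup => _ [X XD <-].
  rewrite -ge0_mule_fsumr//.
  by apply: lee_wpmul2l; [rewrite lee_fin|apply: ereal_sup_ubound; exists X].
apply/eqP; rewrite eq_le le//=.
have [->|cn0] := eqVneq c 0.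
  by rewrite mul0e esum_ge0// => x _; rewrite mul0e.
have {c0 cn0}c0 : 0 < c by rewrite lt_def cn0.
(* Finite partial sums give only one inequality; the other is the same bound for the factor
   [c^-1]. *)
have cK y : (c%:E * (c^-1%:E * y))%E = y.
  by rewrite muleA -EFinM divff ?mul1e// gt_eqF.
rewrite -[leRHS]cK lee_pmul2l ?lte_fin//.
have /le_trans -> // : (\esum_(x in D) f x <= \esum_(x in D) (c^-1%:E * (c%:E * f x)))%E.
  by apply: le_esum => x _; rewrite muleA -EFinM mulVf ?mul1e// gt_eqF.
apply: le => [|x]; first by rewrite invr_ge0 ltW.
by rewrite mule_ge0// lee_fin ltW.
Qed.

Lemma esum_ge_term (I : choiceType) (D : set I) (f : I -> \bar R) x :
  (forall y, D y -> (0 <= f y)%E) -> D x -> (f x <= \esum_(y in D) f y)%E.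
Proof.
move=> f0 Dx; rewrite (esumID [set x])// setI1 mem_set// esum_set1 ?f0//.
by rewrite leeDl// esum_ge0// => y [/f0].
Qed.

(** * Signed sums over a fixed index set *)

Section OneSet.
Variables (I : choiceType) (D : set I).
Implicit Types f g : I -> R.

Lemma rsummable_le f g : (forall x, D x -> `|f x| <= g x) ->
  (\esum_(x in D) (g x)%:E < +oo)%E -> rsummable D f.
Proof.
by move=> fg; apply: le_lt_trans; apply: le_esum => x Dx /=; rewrite lee_fin fg.
Qed.

Lemma esum_fin_num f : (forall x, D x -> 0 <= f x) ->
  (\esum_(x in D) (f x)%:E < +oo)%E -> \esum_(x in D) (f x)%:E \is a fin_num.
Proof.
by move=> f0 foo; rewrite ge0_fin_numE//; apply: esum_ge0 => x /f0; rewrite lee_fin.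
Qed.

(** The positive and negative parts satisfy [f^+ + g2 = f^- + g1], and all four sums are finite.
    This frees [rsum] from the canonical parts, which are not additive in [f]. *)
Lemma rsum_subE f g1 g2 :
  (forall x, D x -> 0 <= g1 x) -> (forall x, D x -> 0 <= g2 x) ->
  (\esum_(x in D) (g1 x)%:E < +oo)%E -> (\esum_(x in D) (g2 x)%:E < +oo)%E ->
  (forall x, D x -> f x = g1 x - g2 x) ->
  rsum D f = fine (\esum_(x in D) (g1 x)%:E) - fine (\esum_(x in D) (g2 x)%:E).
Proof.
move=> g10 g20 g1oo g2oo fE.
have [p0 n0] : (forall x, D x -> 0 <= Num.max (f x) 0) /\
  (forall x, D x -> 0 <= Num.max (- f x) 0).
  by split=> x _; rewrite le_max lexx orbT.
have poo : (\esum_(x in D) (Num.max (f x) 0)%:E < +oo)%E.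
  apply: le_lt_trans g1oo; apply: le_esum => x Dx.
  by rewrite lee_fin ge_max g10// andbT fE// gerBl g20.
have noo : (\esum_(x in D) (Num.max (- f x) 0)%:E < +oo)%E.
  apply: le_lt_trans g2oo; apply: le_esum => x Dx.
  by rewrite lee_fin ge_max g20// andbT fE// opprB gerBl g10.
rewrite /rsum; apply/eqP; rewrite subr_eq addrAC eq_sym subr_eq eq_sym.
rewrite -!fineD ?esum_fin_num//; apply/eqP; congr fine.
rewrite -!esumD//; try by move=> x Dx; rewrite lee_fin ?g10 ?g20 ?p0 ?n0.
apply: eq_esum => x Dx; rewrite -!EFinD fE//; congr (_%:E).
by rewrite /Num.max; case: ifPn; case: ifPn; lra.
Qed.

Lemma rsummable_pos f : rsummable D f ->
  (\esum_(x in D) (Num.max (f x) 0)%:E < +oo)%E.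
Proof.
apply: le_lt_trans; apply: le_esum => x _ /=.
by rewrite lee_fin ge_max ler_norm normr_ge0.
Qed.

Lemma rsummableN f : rsummable D f -> rsummable D (fun x => - f x).
Proof. by rewrite summableN. Qed.

Lemma rsummableD f g : rsummable D f -> rsummable D g ->
  rsummable D (fun x => f x + g x).
Proof. exact: summableD. Qed.

Lemma rsummable0 : rsummable D (fun=> 0 : R).
Proof. by rewrite /summable esum1//= => x _; rewrite normr0. Qed.

Lemma rsummableZ c f : rsummable D f -> rsummable D (fun x => c * f x).
Proof.
move=> sf; rewrite /summable /=.
under eq_esum do rewrite normrM EFinM.
by rewrite esumZl// lte_mul_pinfty// lee_fin.
Qed.

Lemma rsumN f : rsum D (fun x => - f x) = - rsum D f.
Proof.
rewrite /rsum opprB; congr (_ - fine _).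
by apply: eq_esum => x _; rewrite opprK.
Qed.

Lemma rsumD f g : rsummable D f -> rsummable D g ->
  rsum D (fun x => f x + g x) = rsum D f + rsum D g.
Proof.
move=> sf sg; have [sNf sNg] := (rsummableN sf, rsummableN sg).
have P0 (a : I -> R) x : D x -> 0 <= Num.max (a x) 0 by rewrite le_max lexx orbT.
have [pf pg] := (rsummable_pos sf, rsummable_pos sg).
have [nf ng] := (rsummable_pos sNf, rsummable_pos sNg).
have E0 (a : I -> R) x : D x -> (0 <= (Num.max (a x) 0)%:E)%E.
  by move=> Dx; rewrite lee_fin P0.
rewrite (@rsum_subE _ (fun x => Num.max (f x) 0 + Num.max (g x) 0)
   (fun x => Num.max (- f x) 0 + Num.max (- g x) 0)).
- under eq_esum do rewrite EFinD.
  under [in X in _ - X]eq_esum do rewrite EFinD.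
  rewrite !esumD; try (by apply: (E0 f)); try (by apply: (E0 g));
   try (by apply: (E0 (fun x => - f x))); try (by apply: (E0 (fun x => - g x))).
  rewrite !fineD ?esum_fin_num//; try exact: (P0 (fun x => - f x));
   try exact: (P0 (fun x => - g x)); try exact: (P0 f); try exact: (P0 g).
  by rewrite /rsum opprD addrACA.
- by move=> x Dx; rewrite addr_ge0// P0.
- by move=> x Dx; rewrite addr_ge0// ?(P0 (fun x => - f x))// (P0 (fun x => - g x)).
- under eq_esum do rewrite EFinD.
  rewrite esumD; try (by apply: (E0 f)); try (by apply: (E0 g)).
  exact: lte_add_pinfty.
- under eq_esum do rewrite EFinD.
  rewrite esumD; try (by apply: (E0 (fun x => - f x))); try (by apply: (E0 (fun x => - g x))).
  exact: lte_add_pinfty.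
- by move=> x Dx; rewrite /Num.max; do 4?case: ifPn; lra.
Qed.

Lemma eq_rsum f g : (forall x, D x -> f x = g x) -> rsum D f = rsum D g.
Proof.
by move=> fg; rewrite /rsum; congr (fine _ - fine _); apply: eq_esum => x /fg ->.
Qed.

Lemma ler_abs_rsum f : rsummable D f ->
  `|rsum D f| <= fine (\esum_(x in D) `|f x|%:E).
Proof.
move=> sf; rewrite /rsum.
have P0 (a : I -> R) x : D x -> (0 <= (Num.max (a x) 0)%:E)%E.
  by rewrite lee_fin le_max lexx orbT.
have pf := rsummable_pos sf; have nf := rsummable_pos (rsummableN sf).
have -> : \esum_(x in D) (`|f x|)%:E =
  (\esum_(x in D) (Num.max (f x) 0)%:E + \esum_(x in D) (Num.max (- f x) 0)%:E)%E.
  rewrite -esumD; [|exact: P0|exact: (P0 (fun x => - f x))].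
  apply: eq_esum => x _; rewrite -EFinD /Num.max; congr (_%:E).
  by case: ifPn; case: ifPn; case: (ler0P (f x)); lra.
have h (a : I -> R) : (\esum_(x in D) (Num.max (a x) 0)%:E < +oo)%E ->
  \esum_(x in D) (Num.max (a x) 0)%:E \is a fin_num.
  by apply: esum_fin_num => x Dx; rewrite le_max lexx orbT.
have hp := h _ pf; have hn := h (fun x => - f x) nf; rewrite fineD//.
have := @fine_ge0 _ _ (esum_ge0 (P0 f)).
have := @fine_ge0 _ _ (esum_ge0 (P0 (fun x => - f x))).
by rewrite ler_norml; lra.
Qed.

Lemma rsumZ c f : rsummable D f -> rsum D (fun x => c * f x) = c * rsum D f.
Proof.
move=> sf; have pf := rsummable_pos sf; have nf := rsummable_pos (rsummableN sf).
have P0 (a : I -> R) x : 0 <= Num.max (a x) 0 by rewrite le_max lexx orbT.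
have E0 (a : I -> R) x : (0 <= (Num.max (a x) 0)%:E)%E by rewrite lee_fin.
(* A factor [d >= 0] scales both parts separately; a negative factor is reduced to this case by
   [rsumN]. *)
have pos d : 0 <= d -> rsum D (fun x => d * f x) = d * rsum D f.
  move=> d0; have d0E : (0 <= d%:E)%E by rewrite lee_fin.
  have hp := esumZl D d0 (E0 f); have hn := esumZl D d0 (E0 (fun x => - f x)).
  have fp : (\esum_(x in D) (Num.max (f x) 0)%:E \is a fin_num)%E.
    exact: (@esum_fin_num (fun x => Num.max (f x) 0)).
  have fn : (\esum_(x in D) (Num.max (- f x) 0)%:E \is a fin_num)%E.
    by apply: (@esum_fin_num (fun x => Num.max (- f x) 0)) => // x _; exact: (P0 (fun x => - f x)).
  rewrite (@rsum_subE _ (fun x => d * Num.max (f x) 0)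
     (fun x => d * Num.max (- f x) 0)) => [|x _|x _|||x _].
  - under eq_esum do rewrite EFinM.
    under [in X in _ - X]eq_esum do rewrite EFinM.
    by rewrite hp hn !fineM// /rsum mulrBr.
  - by rewrite mulr_ge0.
  - by rewrite mulr_ge0// (P0 (fun x => - f x)).
  - by under eq_esum do rewrite EFinM; rewrite hp lte_mul_pinfty.
  - by under eq_esum do rewrite EFinM; rewrite hn lte_mul_pinfty.
  - rewrite -mulrBr; congr (_ * _).
    by rewrite /Num.max; do 2?case: ifPn; lra.
have [c0|c0] := leP 0 c; first exact: pos.
have -> : rsum D (fun x => c * f x) = - rsum D (fun x => - c * f x).
  by rewrite -rsumN; apply: eq_rsum => x _; rewrite mulNr opprK.
by rewrite pos ?mulNr ?opprK// oppr_ge0 ltW.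
Qed.

Lemma rsummable_sum (K : Type) (r : seq K) (F : K -> I -> R) :
  (forall k, rsummable D (F k)) -> rsummable D (fun x => \sum_(k <- r) F k x).
Proof.
move=> sF; elim: r => [|k r IH].
  by under eq_fun do rewrite big_nil; exact: rsummable0.
by under eq_fun do rewrite big_cons; exact: rsummableD.
Qed.

Lemma rsum0 : rsum D (fun=> 0 : R) = 0.
Proof. by rewrite /rsum oppr0 subrr. Qed.

Lemma rsum_sum (K : Type) (r : seq K) (F : K -> I -> R) :
  (forall k, rsummable D (F k)) ->
  rsum D (fun x => \sum_(k <- r) F k x) = \sum_(k <- r) rsum D (F k).
Proof.
move=> sF; elim: r => [|k r IH].
  by under eq_fun do rewrite big_nil; rewrite big_nil rsum0.
under eq_fun do rewrite big_cons.
by rewrite rsumD ?big_cons ?IH//; exact: rsummable_sum.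
Qed.
End OneSet.

Lemma rsum_reindex (I J : choiceType) (P : set I) (Q : set J) (e : I -> J) (f : J -> R) :
  set_bij P Q e -> rsum Q f = rsum P (fun x => f (e x)).
Proof. by move=> eb; rewrite /rsum !(reindex_esum P Q e). Qed.

(** * Fubini's theorem for signed sums *)

Section Fubini.
Variables (I J : choiceType) (K : set I) (S : I -> set J) (F : I -> J -> R).
Hypothesis sF : rsummable (K `*`` S) (fun x => F x.1 x.2).

Lemma rsummable_fiber k : K k -> rsummable (S k) (F k).
Proof.
move=> Kk; apply: le_lt_trans sF.
rewrite -(esum_esum (a := fun i j => `|(F i j)%:E|%E)); last by move=> *; exact: abse_ge0.
by apply: (esum_ge_term (f := fun i => \esum_(j in S i) _)) => // i _; rewrite esum_ge0.
Qed.

Lemma rsum_rsum : rsum K (fun k => rsum (S k) (F k)) = rsum (K `*`` S) (fun x => F x.1 x.2).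
Proof.
(* The sign [s = 1] selects the positive part of [F], [s = -1] the negative one. Tonelli applies to
   each, and [rsum_subE] recombines them, since every fibre sum is a difference of the two. *)
pose p (s : R) k j := Num.max (s * F k j) 0.
have p0 s k j : 0 <= p s k j by rewrite le_max lexx orbT.
have fib s k : K k -> \esum_(j in S k) (p s k j)%:E \is a fin_num.
  move=> Kk; apply: esum_fin_num => //.
  exact/rsummable_pos/rsummableZ/rsummable_fiber.
have tot s : (\esum_(x in K `*`` S) (p s x.1 x.2)%:E < +oo)%E.
  by have /rsummable_pos := rsummableZ s sF.
have P s : \esum_(k in K) (fine (\esum_(j in S k) (p s k j)%:E))%:E =
    \esum_(x in K `*`` S) (p s x.1 x.2)%:E.
  rewrite -(esum_esum (a := fun i j => (p s i j)%:E)); last by move=> *; rewrite lee_fin.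
  by apply: eq_esum => k Kk; rewrite fineK// fib.
rewrite (@rsum_subE _ _ _ (fun k => fine (\esum_(j in S k) (p 1 k j)%:E))
  (fun k => fine (\esum_(j in S k) (p (-1) k j)%:E))) ?P//.
- congr (fine _ - fine _); apply: eq_esum => x _; rewrite /p ?mul1r//.
  by rewrite mulN1r.
- by move=> k _; rewrite fine_ge0// esum_ge0// => *; rewrite lee_fin.
- by move=> k _; rewrite fine_ge0// esum_ge0// => *; rewrite lee_fin.
- move=> k _; congr (fine _ - fine _); apply: eq_esum => x _; rewrite /p ?mul1r//.
  by rewrite mulN1r.
Qed.
End Fubini.

(* For [B, C > 0] this sums [2 |f g| <= (C / B) f^2 + (B / C) g^2]. *)
Lemma esum_CauchySchwarz (I : choiceType) (D : set I) (f g : I -> R) (B C : R) :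
  0 <= B -> 0 <= C ->
  (\esum_(x in D) (f x ^+ 2)%:E <= (B ^+ 2)%:E)%E ->
  (\esum_(x in D) (g x ^+ 2)%:E <= (C ^+ 2)%:E)%E ->
  (\esum_(x in D) `|f x * g x|%:E <= (B * C)%:E)%E.
Proof.
(* If [B] or [C] vanishes the weights [C / B] and [B / C] degenerate, but then [f] or [g] is zero on
   [D]. *)
have zero (a : I -> R) (A : R) : A = 0 ->
    (\esum_(x in D) (a x ^+ 2)%:E <= (A ^+ 2)%:E)%E -> forall x, D x -> a x = 0.
  move=> -> le0 x Dx; apply/eqP; rewrite -sqrf_eq0 eq_le sqr_ge0 andbT -lee_fin.
  rewrite expr0n/= in le0; apply: le_trans le0.
  by apply: (esum_ge_term (f := fun y => (a y ^+ 2)%:E)) => // y _; rewrite lee_fin sqr_ge0.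
move=> B0 C0 fB gC.
have [B00|Bn0] := eqVneq B 0.
  by rewrite B00 mul0r esum1// => x Dx; rewrite (zero f B)// mul0r normr0.
have [C00|Cn0] := eqVneq C 0.
  by rewrite C00 mulr0 esum1// => x Dx; rewrite (zero g C)// mulr0 normr0.
have {B0 Bn0}B0 : 0 < B by rewrite lt_def Bn0.
have {C0 Cn0}C0 : 0 < C by rewrite lt_def Cn0.
have sq0 (a : I -> R) x : (0 <= (a x ^+ 2)%:E)%E by rewrite lee_fin sqr_ge0.
pose c := C / B / 2; pose d := B / C / 2.
have c0 : 0 <= c by rewrite !divr_ge0// ltW.
have d0 : 0 <= d by rewrite !divr_ge0// ltW.
apply: (@le_trans _ _ (c%:E * (\esum_(x in D) (f x ^+ 2)%:E) +
                       d%:E * (\esum_(x in D) (g x ^+ 2)%:E))%E).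
  rewrite -(esumZl D c0 (sq0 f)) -(esumZl D d0 (sq0 g)) -esumD;
    try by move=> x _; rewrite mule_ge0// lee_fin.
  apply: le_esum => x _; rewrite -!EFinM -EFinD lee_fin ler_norml.
  rewrite /c /d; set r := C / B; have r0 : 0 < r by rewrite divr_gt0.
  have -> : B / C = r^-1 by rewrite invf_div.
  have rK : r * r^-1 = 1 by rewrite divff// gt_eqF.
  have ri0 : 0 < r^-1 by rewrite invr_gt0.
  (* These two weighted squares yield the upper and the lower bound on [f x * g x]. *)
  have h1 := mulr_ge0 (ltW ri0) (sqr_ge0 (r * f x - g x)).
  have h2 := mulr_ge0 (ltW ri0) (sqr_ge0 (r * f x + g x)).
  have e1 : r^-1 * (r * f x - g x) ^+ 2 =
     (r * r^-1) * r * f x ^+ 2 - (r * r^-1) * f x * g x *+ 2 + r^-1 * g x ^+ 2 by ring.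
  have e2 : r^-1 * (r * f x + g x) ^+ 2 =
     (r * r^-1) * r * f x ^+ 2 + (r * r^-1) * f x * g x *+ 2 + r^-1 * g x ^+ 2 by ring.
  rewrite {}e1 rK in h1; rewrite {}e2 rK in h2.
  by apply/andP; split; lra.
apply: (@le_trans _ _ (c%:E * (B ^+ 2)%:E + d%:E * (C ^+ 2)%:E)%E).
  by apply: leeD; apply: lee_wpmul2l; rewrite ?lee_fin.
rewrite -!EFinM -EFinD lee_fin /c /d le_eqVlt; apply/orP; left; apply/eqP.
by field; rewrite !gt_eqF.
Qed.
End RealSums.

(** * Trilinear forms on l^2 *)

Section TrilinearForms.
Variable R : realType.

(* Boundedness on [l^2 * l^2 * l^2] of the trilinear form carried by the triples
   [(x i, y i, z i)] with [i] in [S] *)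
Definition tri_bounded (I X Y Z : choiceType) (S : set I)
    (x : I -> X) (y : I -> Y) (z : I -> Z) : Prop :=
  exists2 K : R, 0 <= K &
  forall (a : X -> R) (b : Y -> R) (c : Z -> R) (A B C : R),
    (forall i, 0 <= a i) -> (forall i, 0 <= b i) -> (forall i, 0 <= c i) ->
    0 <= A -> 0 <= B -> 0 <= C ->
    (\esum_(i in [set: X]) (a i ^+ 2)%:E <= (A ^+ 2)%:E)%E ->
    (\esum_(i in [set: Y]) (b i ^+ 2)%:E <= (B ^+ 2)%:E)%E ->
    (\esum_(i in [set: Z]) (c i ^+ 2)%:E <= (C ^+ 2)%:E)%E ->
    (\esum_(i in S) (a (x i) * b (y i) * c (z i))%:E <= (K * A * B * C)%:E)%E.

Section Basic.
Variables (I X Y Z : choiceType).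
Implicit Types (S : set I) (x : I -> X) (y : I -> Y) (z : I -> Z).

Lemma tri_bounded_sub S S' x y z :
  S' `<=` S -> tri_bounded S x y z -> tri_bounded S' x y z.
Proof.
move=> S'S [K K0 KP]; exists K => // a b c A B C a0 b0 c0 A0 B0 C0 aA bB cC.
apply: le_trans (KP _ _ _ _ _ _ a0 b0 c0 A0 B0 C0 aA bB cC).
apply: (@esum_le_bij _ _ _ S' S id) => // j _.
by rewrite lee_fin !mulr_ge0.
Qed.

Lemma tri_bounded0 x y z : tri_bounded set0 x y z.
Proof.
by exists 0 => // a b c A B C *; rewrite esum_set0 !mul0r.
Qed.

Lemma tri_boundedU S S' x y z :
  tri_bounded S x y z -> tri_bounded S' x y z -> tri_bounded (S `|` S') x y z.
Proof.
move=> [K K0 KP] [L L0 LP]; exists (K + L); first exact: addr_ge0.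
move=> a b c A B C a0 b0 c0 A0 B0 C0 aA bB cC.
have abc0 i : (0 <= (a (x i) * b (y i) * c (z i))%:E)%E by rewrite lee_fin !mulr_ge0.
rewrite (esumID S)// !mulrDl EFinD; apply: leeD.
  apply: le_trans (KP _ _ _ _ _ _ a0 b0 c0 A0 B0 C0 aA bB cC).
  by apply: (@esum_le_bij _ _ _ _ S id) => // i [].
apply: le_trans (LP _ _ _ _ _ _ a0 b0 c0 A0 B0 C0 aA bB cC).
by apply: (@esum_le_bij _ _ _ _ S' id) => // i [[]].
Qed.

Lemma tri_bounded_bigU (T : choiceType) (s : seq T) (F : T -> set I) x y z :
  (forall t, tri_bounded (F t) x y z) ->
  tri_bounded [set i | exists2 t, t \in s & F t i] x y z.
Proof.
move=> Fb; elim: s => [|t s IH].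
  by apply: tri_bounded_sub (tri_bounded0 x y z) => i [t]; rewrite in_nil.
apply: tri_bounded_sub (tri_boundedU (Fb t) IH) => i [t'].
by rewrite in_cons => /orP[/eqP -> Fi|t's Fi]; [left|right; exists t'].
Qed.

(** The coefficient [a] is bounded by its l^2 norm and can be pulled out; Cauchy-Schwarz handles the
    other two, because injectivity turns their sums over [S] into subsums of the full l^2 sums. *)
Lemma tri_bounded_inj23 S x y z : set_inj S y -> set_inj S z -> tri_bounded S x y z.
Proof.
move=> yinj zinj; exists 1 => // a b c A B C a0 b0 c0 A0 B0 C0 aA bB cC.
have aleA j : a j <= A.
  rewrite -(ler_pXn2r (n := 2))// ?nnegrE// -lee_fin; apply: le_trans aA.
  by apply: (esum_ge_term (f := fun i => (a i ^+ 2)%:E)) => // i _; rewrite lee_fin sqr_ge0.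
have sq0 (J : choiceType) (f : J -> R) j : (0 <= (f j ^+ 2)%:E)%E by rewrite lee_fin sqr_ge0.
have le1 : (\esum_(i in S) `|b (y i) * c (z i)|%:E <= (B * C)%:E)%E.
  apply: esum_CauchySchwarz => //.
    by apply: le_trans bB; apply: (@esum_le_bij _ _ _ S setT y (fun j => (b j ^+ 2)%:E)).
  by apply: le_trans cC; apply: (@esum_le_bij _ _ _ S setT z (fun j => (c j ^+ 2)%:E)).
apply: (@le_trans _ _ (\esum_(i in S) (A%:E * `|b (y i) * c (z i)|%:E))%E).
  apply: le_esum => i _; rewrite -EFinM lee_fin -mulrA.
  by rewrite ger0_norm ?mulr_ge0// ler_wpM2r// mulr_ge0.
rewrite esumZl//.
by rewrite mul1r -mulrA EFinM lee_wpmul2l// lee_fin.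
Qed.

End Basic.

Section Permutation.
Variables (I X Y Z : choiceType) (S : set I) (x : I -> X) (y : I -> Y) (z : I -> Z).

Lemma tri_boundedC12 : tri_bounded S x y z -> tri_bounded S y x z.
Proof.
move=> [K K0 KP]; exists K => // a b c A B C a0 b0 c0 A0 B0 C0 aA bB cC.
have := KP _ _ _ _ _ _ b0 a0 c0 B0 A0 C0 bB aA cC.
rewrite -[K * B * A]mulrAC; apply: le_trans; apply: le_esum => i _.
by rewrite (mulrC (b (x i))).
Qed.

Lemma tri_boundedC23 : tri_bounded S x y z -> tri_bounded S x z y.
Proof.
move=> [K K0 KP]; exists K => // a b c A B C a0 b0 c0 A0 B0 C0 aA bB cC.
have := KP _ _ _ _ _ _ a0 c0 b0 A0 C0 B0 aA cC bB.
rewrite -[K * A * C * B]mulrAC; apply: le_trans; apply: le_esum => i _.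
by rewrite mulrAC.
Qed.
End Permutation.

Lemma tri_bounded_inj13 (I X Y Z : choiceType) (S : set I)
    (x : I -> X) (y : I -> Y) (z : I -> Z) :
  set_inj S x -> set_inj S z -> tri_bounded S x y z.
Proof. by move=> *; exact/tri_boundedC12/tri_bounded_inj23. Qed.

Lemma tri_bounded_inj12 (I X Y Z : choiceType) (S : set I)
    (x : I -> X) (y : I -> Y) (z : I -> Z) :
  set_inj S x -> set_inj S y -> tri_bounded S x y z.
Proof. by move=> *; exact/tri_boundedC23/tri_bounded_inj13. Qed.

(* The l^2 norms of the slices serve as new coefficients. *)
Lemma tri_boundedX (I1 X1 Y1 Z1 I2 X2 Y2 Z2 : choiceType) (S1 : set I1) (S2 : set I2)
    (x1 : I1 -> X1) (y1 : I1 -> Y1) (z1 : I1 -> Z1)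
    (x2 : I2 -> X2) (y2 : I2 -> Y2) (z2 : I2 -> Z2) :
  tri_bounded S1 x1 y1 z1 -> tri_bounded S2 x2 y2 z2 ->
  tri_bounded (S1 `*` S2) (fun i => (x1 i.1, x2 i.2)) (fun i => (y1 i.1, y2 i.2))
    (fun i => (z1 i.1, z2 i.2)).
Proof.
move=> [K K0 KP] [L L0 LP]; exists (L * K); first exact: mulr_ge0.
move=> a b c A B C a0 b0 c0 A0 B0 C0 aA bB cC.
pose slice (J J' : choiceType) (f : J * J' -> R) j :=
  Num.sqrt (fine (\esum_(j' in [set: J']) (f (j, j') ^+ 2)%:E)).
have slice0 J J' f j : 0 <= @slice J J' f j by exact: sqrtr_ge0.
have sq0 (r : R) : (0 <= (r ^+ 2)%:E)%E by rewrite lee_fin sqr_ge0.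
have setXXE (U V : choiceType) (M : set U) (N : set V) : M `*` N = M `*`` (fun=> N).
  by [].
have tot (J J' : choiceType) (f : J * J' -> R) :
    \esum_(j in [set: J]) \esum_(j' in [set: J']) (f (j, j') ^+ 2)%:E =
    \esum_(j in [set: J * J']) (f j ^+ 2)%:E.
  rewrite esum_esum//= -setXXE setXTT; apply: eq_esum => -[]//.
have sliceE (J J' : choiceType) (f : J * J' -> R) (D : R) j :
    (\esum_(j in [set: J * J']) (f j ^+ 2)%:E <= (D ^+ 2)%:E)%E ->
    (* Since [fine] sends [+oo] to [0], the bound by [D] is what guarantees that a slice norm is the
       true one. *)
    ((slice J J' f j ^+ 2)%:E = \esum_(j' in [set: J']) (f (j, j') ^+ 2)%:E)%E.
  move=> fD; rewrite sqr_sqrtr ?fine_ge0 ?esum_ge0// fineK// ge0_fin_numE ?esum_ge0//.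
  apply: le_lt_trans (ltry (D ^+ 2)); apply: le_trans fD.
  rewrite -tot.
  apply: (esum_ge_term (f := fun i => \esum_(j' in [set: J']) (f (i, j') ^+ 2)%:E)) => // i _.
  exact: esum_ge0.
have sliceD (J J' : choiceType) (f : J * J' -> R) (D : R) :
    (\esum_(j in [set: J * J']) (f j ^+ 2)%:E <= (D ^+ 2)%:E)%E ->
    (\esum_(j in [set: J]) (slice J J' f j ^+ 2)%:E <= (D ^+ 2)%:E)%E.
  by move=> fD; apply: (le_trans _ fD); rewrite -tot; apply: le_esum => j _;
    rewrite (sliceE _ _ _ D).
rewrite setXXE -(esum_esum
  (a := fun i j => (a (x1 i, x2 j) * b (y1 i, y2 j) * c (z1 i, z2 j))%:E)); last first.
  by move=> *; rewrite lee_fin !mulr_ge0.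
(* For a fixed triple of [S1] the second form acts on slices, at the cost of [L]; the slice norms
   then enter the first form. *)
have /le_trans -> // : (\esum_(i in S1) \esum_(j in S2)
     (a (x1 i, x2 j) * b (y1 i, y2 j) * c (z1 i, z2 j))%:E <=
   \esum_(i in S1) (L%:E * (slice _ _ a (x1 i) * slice _ _ b (y1 i) * slice _ _ c (z1 i))%:E))%E.
  apply: le_esum => i _; rewrite -EFinM !mulrA.
  apply: (LP (fun j => a (x1 i, j)) (fun j => b (y1 i, j)) (fun j => c (z1 i, j))) => //.
  - by rewrite (sliceE _ _ _ A).
  - by rewrite (sliceE _ _ _ B).
  - by rewrite (sliceE _ _ _ C).
rewrite esumZl// => [|i]; last by rewrite lee_fin !mulr_ge0.
rewrite -!(mulrA L) EFinM lee_wpmul2l// ?lee_fin//.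
by apply: KP => //; exact: sliceD.
Qed.

(** Coefficients on [X'] are pulled back along the injective [e], which does not increase their l^2
    norm, and [f] embeds the new index set into the old one. This passes from nested pairs of
    coordinates to row vectors. *)
Lemma tri_bounded_transfer (I I' X X' : choiceType) (S : set I) (S' : set I')
    (x y z : I -> X) (x' y' z' : I' -> X') (f : I' -> I) (e : X -> X') :
  injective e -> set_inj S' f -> (forall i, S' i -> S (f i)) ->
  (forall i, S' i -> [/\ e (x (f i)) = x' i, e (y (f i)) = y' i & e (z (f i)) = z' i]) ->
  tri_bounded S x y z -> tri_bounded S' x' y' z'.
Proof.
move=> einj finj fS fe [K K0 KP]; exists K => // a b c A B C a0 b0 c0 A0 B0 C0 aA bB cC.
have sqe (g : X' -> R) : (\esum_(i in [set: X]) (g (e i) ^+ 2)%:E <=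
    \esum_(i in [set: X']) (g i ^+ 2)%:E)%E.
  apply: (@esum_le_bij _ _ _ setT setT e (fun j => (g j ^+ 2)%:E)) => //.
    by move=> u v _ _; exact: einj.
  by move=> j _; rewrite lee_fin sqr_ge0.
apply: (@le_trans _ _ (\esum_(i in S) (a (e (x i)) * b (e (y i)) * c (e (z i)))%:E)%E); last first.
  apply: (KP (a \o e) (b \o e) (c \o e)) => //=.
  - exact: le_trans (sqe a) aA.
  - exact: le_trans (sqe b) bB.
  - exact: le_trans (sqe c) cC.
have -> : \esum_(i in S') (a (x' i) * b (y' i) * c (z' i))%:E =
    \esum_(i in S') ((fun j => (a (e (x j)) * b (e (y j)) * c (e (z j)))%:E) (f i)).
  by apply: eq_esum => i /fe[-> -> ->].
by apply: esum_le_bij => // j _; rewrite lee_fin !mulr_ge0.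
Qed.
End TrilinearForms.

(** * Triads of the log-lattice *)

Section Triads.
Variable R : realType.
Implicit Types l : R.

(** * Ratios within a one-dimensional triad *)

Lemma lambda_gt1 l : lambda_ok l -> 1 < l.
Proof.
case=> [->|[lP|[a [b [_ _ _ _ []]]]]]//; first by rewrite ltr1n.
rewrite ltNge; apply/negP => l1.
(* [x^3 - x - 1] is negative on [x <= 1]: its local maximum is near [x = - 3 / 5]. *)
have : 0 <= (l + 3 / 5) ^+ 2 * (6 / 5 - l) by rewrite mulr_ge0 ?sqr_ge0//; lra.
have -> : (l + 3 / 5) ^+ 2 * (6 / 5 - l) = - (l ^+ 3 - l - 1) + 2 / 25 * l - 71 / 125 by field.
by rewrite lP; lra.
Qed.

Lemma le_expr_bernoulli l n : 1 <= l -> 1 + n%:R * (l - 1) <= l ^+ n.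
Proof.
move=> l1; elim: n => [|n IH]; first by rewrite mul0r addr0.
have n0 : 0 <= n%:R :> R by [].
have := mulr_ge0 n0 (sqr_ge0 (l - 1)).
have l0 : 0 <= l by lra.
have := ler_wpM2l l0 IH; rewrite -natr1 [l ^+ n.+1]exprS; lra.
Qed.

Lemma expr_unbounded l (M : R) : 1 < l -> exists n, M < l ^+ n.
Proof.
move=> l1; have l10 : 0 < l - 1 by rewrite subr_gt0.
pose n := Num.bound `|M / (l - 1)|; exists n.
apply: lt_le_trans (le_expr_bernoulli n (ltW l1)).
have : M / (l - 1) < n%:R by exact: le_lt_trans (ler_norm _) (archi_boundP (normr_ge0 _)).
by rewrite ltr_pdivrMr//; lra.
Qed.

Lemma norm_Lam l x : 1 < l -> Lam l x -> x != 0 -> exists n, `|x| = l ^+ n.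
Proof.
move=> l1 [->|[n xE]]; first by rewrite eqxx.
have ln0 : 0 <= l ^+ n by rewrite exprn_ge0//; lra.
by move=> _; exists n; case: xE => ->; rewrite ?normrN ger0_norm.
Qed.

(** If [x] were much larger than [y], the moduli of [x] and [x - y] would be powers of [l] differing
    by a factor strictly between [l^-1] and [l], hence equal. This leaves [y = 0] or [y = 2 * x],
    and the latter is too large. *)
Lemma Lam_gap l : 1 < l -> exists E, forall x y, Lam l x -> Lam l y -> Lam l (x - y) ->
  y != 0 -> x - y != 0 -> `|x| < l ^+ E * `|y|.
Proof.
(* With [l ^+ E > l / (l - 1)], a failing bound means [|y| < (1 - 1 / l) |x|]. So [|x - y|] exceeds
   [|x| / l] and stays below [(2 - 1 / l) |x|], which is at most [l |x|]. *)
move=> l1; have [E EP] := expr_unbounded (l / (l - 1)) l1.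
have l10 : 0 < l - 1 by rewrite subr_gt0.
move: EP; rewrite ltr_pdivrMr// => EP.
have g1 : 1 <= l ^+ E by rewrite exprn_ege1// ltW.
exists E => x y Lx Ly Lxy y0 xy0; rewrite ltNge; apply/negP => xy.
have ay : 0 < `|y| by rewrite normr_gt0.
have yx : `|y| <= `|x| by apply: le_trans xy; rewrite ler_peMl.
have x0 : x != 0 by rewrite -normr_gt0; apply: lt_le_trans yx.
have [a aE] := norm_Lam l1 Lx x0; have [c cE] := norm_Lam l1 Lxy xy0.
have gy : l * `|y| < (l - 1) * `|x|.
  apply: (@lt_le_trans _ _ ((l - 1) * (l ^+ E * `|y|))); last by rewrite ler_wpM2l// ltW.
  by rewrite mulrA ltr_pM2r// mulrC.
have up : `|x - y| < l * `|x| by have := ler_normB x y; nra.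
have lo : `|x| < l * `|x - y|.
  have : `|x| - `|y| <= `|x - y| by exact: lerB_dist.
  nra.
have ac : `|x - y| = `|x|.
  rewrite aE cE in up lo *; rewrite -exprS in up; rewrite -exprS in lo.
  rewrite !ltr_eXn2l// !ltnS in up lo.
  by congr (_ ^+ _); apply/eqP; rewrite eqn_leq up lo.
have /eqP := ac; rewrite eqr_norm2 => /orP[/eqP e|/eqP e].
  by move/eqP: y0; apply; lra.
have yE : y = 2 * x by lra.
move: xy; rewrite yE normrM ger0_norm//.
have : 0 < `|x| by rewrite normr_gt0.
nra.
Qed.

(* The ratios are [0], [1] and [+- l ^ n] with [|n|] bounded. *)
Lemma Lam_ratio l : 1 < l -> exists cs : seq R, forall p q, Lam l p -> Lam l q ->
  Lam l (p + q) -> p + q != 0 -> exists2 c, c \in cs & p = c * (p + q).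
Proof.
move=> l1; have [E EP] := Lam_gap l1.
pose L := [seq l ^+ n | n <- iota 0 E] ++ [seq l ^- n | n <- iota 0 E].
exists (0 :: 1 :: L ++ [seq - r | r <- L]) => p q Lp Lq Lk k0.
have [->|p0] := eqVneq p 0; first by exists 0; rewrite ?mul0r ?mem_head.
have [->|q0] := eqVneq q 0.
  by exists 1; rewrite ?addr0 ?mul1r// !in_cons eqxx orbT.
have LN x : Lam l x -> Lam l (- x).
  case=> [->|[n [->|->]]]; first by left; rewrite oppr0.
    by right; exists n; right.
  by right; exists n; left; rewrite opprK.
have pq : p - (p + q) = - q by ring.
have qq : p + q - p = q by ring.
(* The gap is used in both directions, for [p] against [p + q] and for [p + q] against [p], so that
   the exponent of the ratio is below [E] in absolute value. *)
have pk := EP _ _ Lp Lk; rewrite pq oppr_eq0 in pk; have {}pk := pk (LN _ Lq) k0 q0.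
have kp := EP _ _ Lk Lp; rewrite qq in kp; have {}kp := kp Lq p0 q0.
have [a aE] := norm_Lam l1 Lp p0; have [c cE] := norm_Lam l1 Lk k0.
rewrite aE cE -exprD ltr_eXn2l// in pk kp; rewrite -exprD ltr_eXn2l// in kp.
have rL : `|p / (p + q)| \in L.
  rewrite normf_div aE cE mem_cat; apply/orP.
  have ln n : l ^+ n != 0 by rewrite expf_neq0// gt_eqF//; lra.
  have [ca|ac] := leqP c a; [left|right]; apply/mapP.
    exists (a - c)%N; first by rewrite mem_iota /= add0n (ltn_subLR _ ca) addnC.
    by rewrite -{1}(subnK ca) exprD mulfK.
  exists (c - a)%N; first by rewrite mem_iota /= add0n (ltn_subLR _ (ltnW ac)) addnC.
  by rewrite -{1}(subnK (ltnW ac)) exprD invfM mulrCA divff// mulr1.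
exists (p / (p + q)); last by rewrite divfK.
rewrite !in_cons mem_cat; apply/orP; right; apply/orP; right; apply/orP.
have [r0|r0] := leP 0 (p / (p + q)); first by left; rewrite ger0_norm in rL.
by right; apply/mapP; exists `|p / (p + q)|; rewrite ?ltr0_norm ?opprK// -ltr0_norm.
Qed.

Definition triads1 l : set (R * (R * R)) :=
  [set t | [/\ Lam l t.1, Lam l t.2.1, Lam l t.2.2 & t.2.1 + t.2.2 = t.1]].

(** The triads with [k != 0] lie on finitely many lines [p = c * k]. On each piece two entries each
    determine the triad: [p] and [q] if [k = 0], [q] and [k] if [c = 0], [p] and [k] otherwise. *)
Lemma tri_bounded_triads1 l : 1 < l ->
  tri_bounded R (triads1 l) (fun t => t.2.1) (fun t => t.2.2) (fun t => t.1).
Proof.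
move=> /Lam_ratio [cs csP].
pose line c := [set t : R * (R * R) | t.2.1 = c * t.1 /\ t.2.1 + t.2.2 = t.1].
pose zero := [set t : R * (R * R) | t.1 = 0 /\ t.2.1 + t.2.2 = t.1].
apply: (@tri_bounded_sub _ _ _ _ _ (zero `|` [set t | exists2 c, c \in cs & line c t])).
  case=> k [p q] [/= Lk Lp Lq kE]; have [k0|k0] := eqVneq k 0; first by left.
  right; rewrite -kE in Lk k0; have [c ccs pE] := csP _ _ Lp Lq Lk k0.
  by exists c => //=; split=> //=; rewrite -kE.
apply: tri_boundedU.
  apply: tri_bounded_inj12 => -[k [p q]] [k' [p' q']]; rewrite !inE /zero/=;
    move=> [-> e] [-> e'] E; congr (_, (_, _)); lra.
apply: tri_bounded_bigU => c.
have [->|c0] := eqVneq c 0.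
  apply: tri_bounded_inj23 => -[k [p q]] [k' [p' q']]; rewrite !inE /line/=;
    move=> [-> e] [-> e'] E; congr (_, (_, _)); lra.
apply: tri_bounded_inj13 => -[k [p q]] [k' [p' q']]; rewrite !inE /line/=;
  move=> [pE e] [p'E e'] E.
- have kk : k = k' by apply: (mulfI c0); rewrite -pE -p'E.
  by congr (_, (_, _)); lra.
- have pp : p = p' by rewrite pE p'E E.
  by congr (_, (_, _)); lra.
Qed.

(** This is the index set of the sum in [conv]. *)
Definition fiber l (k : 'rV[R]_3) := [set pq : 'rV[R]_3 * 'rV[R]_3 |
  [/\ Lam3 l pq.1, Lam3 l pq.2 & pq.1 + pq.2 = k]].

(** Triads are fibred over [k = p + q], so that [rsum_rsum] merges the sum over [k] of an inner
    product with the convolution sum inside it. *)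
Definition triads l : set ('rV[R]_3 * ('rV[R]_3 * 'rV[R]_3)) := Lam3 l `*`` fiber l.

(** The relation [p + q = k] and membership in the lattice are coordinatewise, so a triad is three
    one-dimensional triads and [tri_boundedX] applies twice. *)
Lemma tri_bounded_triads l : 1 < l ->
  tri_bounded R (triads l) (fun t => t.2.1) (fun t => t.2.2) (fun t => t.1).
Proof.
move=> l1; have T1 := tri_bounded_triads1 l1.
have T3 := tri_boundedX T1 (tri_boundedX T1 T1).
(* [coord] regroups a triad by coordinates, while [row3] reassembles a row from nested pairs. *)
pose row3 (v : R * (R * R)) : 'rV[R]_3 := \row_j nth 0 [:: v.1; v.2.1; v.2.2] j.
pose coord (t : 'rV[R]_3 * ('rV[R]_3 * 'rV[R]_3)) (j : 'I_3) :=
  (t.1 ord0 j, (t.2.1 ord0 j, t.2.2 ord0 j)).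
pose j0 : 'I_3 := inord 0; pose j1 : 'I_3 := inord 1; pose j2 : 'I_3 := inord 2.
have row3E (v : 'rV[R]_3) : row3 (v ord0 j0, (v ord0 j1, v ord0 j2)) = v.
  apply/rowP => j; rewrite mxE; case: j => -[|[|[|//]]] lt_j /=;
  by congr (v _ _); apply/val_inj; rewrite /= inordK.
apply: (tri_bounded_transfer (f := fun t => (coord t j0, (coord t j1, coord t j2)))
   (e := row3) _ _ _ _ T3).
- move=> [a [b c]] [a' [b' c']] /rowP E.
  by have := (E j0, E j1, E j2); rewrite !mxE !inordK//= => -[[-> ->] ->].
- move=> [k [p q]] [k' [p' q']] _ _ [E1 E2 E3 E4 E5 E6 E7 E8 E9].
  by rewrite -(row3E k) -(row3E p) -(row3E q) E1 E2 E3 E4 E5 E6 E7 E8 E9 !row3E.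
- move=> [k [p q]] [/= Lk [Lp Lq kE]].
  by split; [|split]; split=> /=; rewrite ?Lk ?Lp ?Lq// -kE mxE.
- by move=> [k [p q]] _ /=; rewrite !row3E.
Qed.
End Triads.

(** * Vector fields *)

Section Fields.
Variable R : realType.
Local Notation C := R[i].
Local Notation Re := complex.Re.
Local Notation Im := complex.Im.
Local Notation normc := Normc.normc.
Local Notation field := ('rV[R]_3 -> 'rV[C]_3).
Implicit Types (l : R) (a b c : field) (k p q : 'rV[R]_3) (v w : 'rV[C]_3).

(** * Moduli and the real part of the Hermitian product *)

Lemma cabs2_ge0 (z : C) : 0 <= cabs2 z.
Proof. by rewrite addr_ge0 ?sqr_ge0. Qed.

Lemma sqr_normcE (z : C) : normc z ^+ 2 = cabs2 z.
Proof. by case: z => x y; rewrite /= sqr_sqrtr// addr_ge0 ?sqr_ge0. Qed.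

Lemma normc_ge0 (z : C) : 0 <= normc z.
Proof. by case: z => x y; exact: sqrtr_ge0. Qed.

Lemma normc_conj (z : C) : normc z^* = normc z.
Proof. by case: z => x y; rewrite /= sqrrN. Qed.

Lemma Re_le_normc (z : C) : `|Re z| <= normc z.
Proof.
by case: z => x y /=; rewrite -sqrtr_sqr ler_wsqrtr// lerDl sqr_ge0.
Qed.

Lemma Im_le_normc (z : C) : `|Im z| <= normc z.
Proof.
by case: z => x y /=; rewrite -sqrtr_sqr ler_wsqrtr// lerDr sqr_ge0.
Qed.

Lemma normcR (r : R) : normc r%:C = `|r|.
Proof. by rewrite /= expr0n /= addr0 sqrtr_sqr. Qed.

Lemma normci : normc ('i : C) = 1.
Proof. by rewrite /= expr0n expr1n /= add0r sqrtr1. Qed.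

Lemma ReD (z w : C) : Re (z + w) = Re z + Re w.
Proof. by case: z w => x y [x' y']. Qed.

Lemma Re_sum (I : Type) (r : seq I) (F : I -> C) : Re (\sum_(i <- r) F i) = \sum_(i <- r) Re (F i).
Proof. by elim: r => [|i r IH]; rewrite ?big_nil// !big_cons ReD IH. Qed.

Lemma ReN (z : C) : Re (- z) = - Re z.
Proof. by case: z. Qed.

Lemma ReM (z w : C) : Re (z * w) = Re z * Re w - Im z * Im w.
Proof. by case: z w => x y [x' y']. Qed.

Definition vsq (v : 'rV[C]_3) : R := \sum_(i < 3) cabs2 (v ord0 i).
Definition vlen (v : 'rV[C]_3) : R := Num.sqrt (vsq v).
(** Keeping only the real part makes the product symmetric and real bilinear; [innerE] shows that
    the imaginary parts cancel in the sum over the lattice. *)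
Definition vdot (v w : 'rV[C]_3) : R := Re (\sum_(i < 3) v ord0 i * (w ord0 i)^*).

Lemma vsq_ge0 v : 0 <= vsq v.
Proof. by apply: sumr_ge0 => i _; exact: cabs2_ge0. Qed.

Lemma sqr_vlen v : vlen v ^+ 2 = vsq v.
Proof. by rewrite sqr_sqrtr// vsq_ge0. Qed.

Lemma vlen_ge0 v : 0 <= vlen v.
Proof. exact: sqrtr_ge0. Qed.

Lemma normc_le_vlen v i : normc (v ord0 i) <= vlen v.
Proof.
rewrite -(ler_pXn2r (n := 2))// ?nnegrE ?vlen_ge0 ?normc_ge0// sqr_vlen sqr_normcE.
by rewrite /vsq (bigD1 i)//= lerDl sumr_ge0// => j _; exact: cabs2_ge0.
Qed.

Lemma vdotE v w : vdot v w =
  \sum_(i < 3) (Re (v ord0 i) * Re (w ord0 i) + Im (v ord0 i) * Im (w ord0 i)).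
Proof.
rewrite /vdot Re_sum; apply: eq_bigr => i _.
by case: (v ord0 i) (w ord0 i) => x y [x' y'] /=; rewrite mulrN opprK.
Qed.

Lemma vdotC v w : vdot v w = vdot w v.
Proof. by rewrite !vdotE; apply: eq_bigr => i _; ring. Qed.

Lemma vdotDl v v' w : vdot (v + v') w = vdot v w + vdot v' w.
Proof.
by rewrite /vdot -ReD -big_split/=; congr Re; apply: eq_bigr => i _; rewrite mxE mulrDl.
Qed.

Lemma vdotNl v w : vdot (- v) w = - vdot v w.
Proof.
by rewrite /vdot -ReN -sumrN; congr Re; apply: eq_bigr => i _; rewrite mxE mulNr.
Qed.

Lemma vdotZl (s : R) v w : vdot (s%:C *: v) w = s * vdot v w.
Proof.
rewrite !vdotE mulr_sumr; apply: eq_bigr => i _; rewrite mxE.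
by case: (v ord0 i) (w ord0 i) => x y [x' y'] /=; ring.
Qed.

Lemma vdotDr v v' w : vdot w (v + v') = vdot w v + vdot w v'.
Proof. by rewrite vdotC vdotDl !(vdotC w). Qed.

Lemma vdotNr v w : vdot w (- v) = - vdot w v.
Proof. by rewrite vdotC vdotNl (vdotC w). Qed.

Lemma vdotZr (s : R) v w : vdot w (s%:C *: v) = s * vdot w v.
Proof. by rewrite vdotC vdotZl (vdotC w). Qed.

Lemma vdot0l w : vdot 0 w = 0.
Proof. by rewrite /vdot big1// => i _; rewrite mxE mul0r. Qed.

Lemma vdot_le v w : `|vdot v w| <= 3 * (vlen v * vlen w).
Proof.
rewrite /vdot Re_sum; apply: le_trans (ler_norm_sum _ _ _) _.
have -> : 3 * (vlen v * vlen w) = \sum_(i < 3) vlen v * vlen w.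
  by rewrite sumr_const card_ord mulr_natl.
apply: ler_sum => i _; apply: le_trans (Re_le_normc _) _.
rewrite Normc.normcM normc_conj; apply: ler_pM; rewrite ?normc_ge0//; exact: normc_le_vlen.
Qed.

(* [Re] of the [(k, p, q)] term, [k = p + q], of the inner product of [a * grad b] with [c] *)
Definition triple a b c (t : 'rV[R]_3 * ('rV[R]_3 * 'rV[R]_3)) : R :=
  Re (\sum_(i < 3) \sum_(j < 3)
    a t.2.1 ord0 j * ('i * (t.2.2 ord0 j)%:C * b t.2.2 ord0 i) * (c t.1 ord0 i)^*).

(** The term factors into the symbol [i q . a(p)] of the transport operator and the Hermitian
    product of [b q] with [c k]; the integration by parts acts on each factor by conjugation. *)
Lemma tripleE a b c k p q :
  triple a b c (k, (p, q)) = Re ('i * (\sum_(j < 3) (q ord0 j)%:C * a p ord0 j) *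
    (\sum_(i < 3) b q ord0 i * (c k ord0 i)^*)).
Proof.
rewrite /triple/=; congr Re; rewrite mulr_sumr; apply: eq_bigr => i _.
rewrite mulr_sumr mulr_suml; apply: eq_bigr => j _.
by rewrite mulrCA !mulrA; congr (_ * _); rewrite -!mulrA; congr (_ * _); rewrite mulrC -!mulrA.
Qed.

Definition klen (k : 'rV[R]_3) : R := Num.sqrt (\sum_(j < 3) k ord0 j ^+ 2).

Lemma klen_ge0 k : 0 <= klen k.
Proof. exact: sqrtr_ge0. Qed.

Lemma coord_le_klen k j : `|k ord0 j| <= klen k.
Proof.
rewrite -sqrtr_sqr ler_wsqrtr// (bigD1 j)//= lerDl sumr_ge0// => i _.
exact: sqr_ge0.
Qed.

Lemma product_le a b i j p q :
  normc (a p ord0 j * ('i * (q ord0 j)%:C * b q ord0 i)) <= vlen (a p) * (klen q * vlen (b q)).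
Proof.
rewrite !Normc.normcM normci mul1r normcR; apply: ler_pM; rewrite ?mulr_ge0 ?normc_ge0//.
  exact: normc_le_vlen.
by apply: ler_pM; rewrite ?normc_ge0// ?coord_le_klen// normc_le_vlen.
Qed.

Lemma triple_le a b c t :
  `|triple a b c t| <= 9 * (vlen (a t.2.1) * (klen t.2.2 * vlen (b t.2.2)) * vlen (c t.1)).
Proof.
set B := (X in 9 * X).
(* The constant counts the index pairs [(i, j)]. *)
have -> : 9 * B = \sum_(i < 3) \sum_(j < 3) B.
  by rewrite !sumr_const card_ord -mulrnA mulr_natl.
rewrite /triple Re_sum; apply: le_trans (ler_norm_sum _ _ _) _; apply: ler_sum => i _.
rewrite Re_sum; apply: le_trans (ler_norm_sum _ _ _) _; apply: ler_sum => j _.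
apply: le_trans (Re_le_normc _) _; rewrite Normc.normcM normc_conj.
by apply: ler_pM; rewrite ?normc_ge0// ?product_le// normc_le_vlen.
Qed.

(* Moving the derivative from [b] to [c] flips the sign: reality turns [a p] into
   [a (- p)], and [div a = 0] allows to replace the wave number [q] by [k = p + q]. *)
Lemma triple_skew l a b c k p q : real_vfield l a -> (forall k, Lam3 l k -> div a k = 0) ->
  Lam3 l p -> p + q = k -> triple a b c (k, (p, q)) = - triple a c b (q, (- p, k)).
Proof.
move=> ra da Lp kE; rewrite !tripleE.
have pa0 : \sum_(j < 3) (p ord0 j)%:C * a p ord0 j = 0.
  have := da _ Lp; rewrite /div.
  under eq_bigr do rewrite -mulrA; rewrite -mulr_sumr => /eqP.
  rewrite mulf_eq0 => /orP[|/eqP ->//].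
  by rewrite eq_complex/= oner_eq0 andbF.
have -> : \sum_(j < 3) (k ord0 j)%:C * a (- p) ord0 j =
    (\sum_(j < 3) (q ord0 j)%:C * a p ord0 j)^*.
  rewrite -[X in X^*]addr0 -[X in _ + X]pa0 -big_split/= rmorph_sum; apply: eq_bigr => j _.
  by rewrite ra// -mulrDl [in RHS]rmorphM -rmorphD
    [X in X * _ = _](_ : _ = (q ord0 j + p ord0 j)%:C^*) // conjc_real -kE mxE addrC.
have -> : \sum_(i < 3) c k ord0 i * (b q ord0 i)^* = (\sum_(i < 3) b q ord0 i * (c k ord0 i)^*)^*.
  by rewrite rmorph_sum; apply: eq_bigr => i _; rewrite rmorphM/= conjcK mulrC.
move: (\sum_(j < 3) _) (\sum_(i < 3) _) => -[x y] [x' y'] /=; ring.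
Qed.

End Fields.

(** * The time derivative of the pairing *)

Section Energy.
Variable R : realType.
Local Notation C := R[i].
Local Notation Re := complex.Re.
Local Notation Im := complex.Im.
Local Notation normc := Normc.normc.
Local Notation field := ('rV[R]_3 -> 'rV[C]_3).
Implicit Types (l : R) (a b c : field) (k p q : 'rV[R]_3) (m : nat).

(** Unlike in [hm_sq], the mode [k = 0] is included; fields of V^m vanish there. *)
Definition l2sq l a : \bar R := \esum_(k in Lam3 l) (vsq (a k))%:E.
Definition pairing l a b : R := rsum (Lam3 l) (fun k => vdot (a k) (b k)).

Lemma l2sq_ge0 l a : (0 <= l2sq l a)%E.
Proof. by rewrite esum_ge0// => k _; rewrite lee_fin vsq_ge0. Qed.

Lemma Lam3_opp l k : Lam3 l k -> Lam3 l (- k).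
Proof.
move=> Lk j; rewrite mxE; case: (Lk j) => [->|[n [->|->]]].
- by left; rewrite oppr0.
- by right; exists n; right.
- by right; exists n; left; rewrite opprK.
Qed.

(** Some coordinate is nonzero, and its modulus is a power of [l]. This spectral gap is why the h^m
    norm dominates the norms of lower order. *)
Lemma Lam3_sqr_ge1 l k : 1 < l -> Lam3 l k -> k != 0 -> 1 <= \sum_(j < 3) k ord0 j ^+ 2.
Proof.
move=> l1 Lk k0; have [j kj0] : exists j, k ord0 j != 0.
  apply/existsP; apply: contraNT k0; rewrite negb_exists => /forallP k0.
  by apply/eqP/rowP => j; rewrite mxE; apply/eqP; have := k0 j; rewrite negbK.
have [n nE] := norm_Lam l1 (Lk j) kj0.
rewrite (bigD1 j)//= -[k ord0 j ^+ 2]real_normK ?num_real// nE.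
rewrite ler_wpDr//; first by apply: sumr_ge0 => i _; exact: sqr_ge0.
by rewrite -exprM exprn_ege1// ltW.
Qed.

Lemma esum_le_hm_sq l m a (g : 'rV[R]_3 -> R) : 1 < l ->
  (forall k, 0 <= g k) -> g 0 = 0 ->
  (forall k, Lam3 l k -> k != 0 -> g k <= (\sum_(j < 3) k ord0 j ^+ 2) ^+ m * vsq (a k)) ->
  (\esum_(k in Lam3 l) (g k)%:E <= hm_sq l m a)%E.
Proof.
move=> l1 g0 g00 gle; rewrite /hm_sq.
have -> : [set k | Lam3 l k /\ k != 0] = Lam3 l `&` [set k | k != 0] by [].
rewrite esum_mkcondr; apply: le_esum => k Lk; have [->|k0] := eqVneq k 0.
  by rewrite memNset ?g00//= eqxx.
by rewrite mem_set// lee_fin gle.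
Qed.

Lemma l2sq_le_hm_sq l m a : 1 < l -> a 0 = 0 -> (l2sq l a <= hm_sq l m a)%E.
Proof.
move=> l1 a0; apply: esum_le_hm_sq => // [k||k Lk k0]; first exact: vsq_ge0.
  by rewrite a0 /vsq big1// => i _; rewrite mxE /cabs2 expr0n addr0.
by rewrite ler_peMl ?vsq_ge0// exprn_ege1// (Lam3_sqr_ge1 l1).
Qed.

(** One derivative costs [|k|^2], which is at most the weight [|k|^{2m}] because [|k| >= 1] and
    [m >= 1]. *)
Lemma grad_l2sq_le_hm_sq l m a : 1 < l -> a 0 = 0 -> (1 <= m)%N ->
  (\esum_(k in Lam3 l) ((klen k * vlen (a k)) ^+ 2)%:E <= hm_sq l m a)%E.
Proof.
move=> l1 a0 m1; have S0 k : 0 <= \sum_(j < 3) k ord0 j ^+ 2.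
  by apply: sumr_ge0 => j _; exact: sqr_ge0.
apply: esum_le_hm_sq => // [k||k Lk k0]; first exact: sqr_ge0.
  rewrite /klen big1 ?sqrtr0 ?mul0r ?expr0n// => j _.
  by rewrite mxE expr0n.
rewrite exprMn sqr_vlen sqr_sqrtr// ler_wpM2r ?vsq_ge0//.
by rewrite -[leLHS]expr1 ler_weXn2l// (Lam3_sqr_ge1 l1).
Qed.

Lemma inV_l2sq l m a : 1 < l -> inV l m a -> (l2sq l a < +oo)%E.
Proof. by move=> l1 [_ a0 _]; apply: le_lt_trans; exact: l2sq_le_hm_sq. Qed.

Lemma esum_vdot_le l a b (A B : R) : 0 <= A -> 0 <= B ->
  (l2sq l a <= (A ^+ 2)%:E)%E -> (l2sq l b <= (B ^+ 2)%:E)%E ->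
  (\esum_(k in Lam3 l) `|vdot (a k) (b k)|%:E <= (3 * (A * B))%:E)%E.
Proof.
move=> A0 B0 aA bB.
apply: (@le_trans _ _ (\esum_(k in Lam3 l) (3%:E * `|vlen (a k) * vlen (b k)|%:E))%E).
  apply: le_esum => k _; rewrite -EFinM lee_fin
    (@ger0_norm _ (vlen _ * vlen _)) ?mulr_ge0 ?vlen_ge0//.
  exact: vdot_le.
rewrite esumZl// EFinM lee_wpmul2l//; apply: esum_CauchySchwarz => //.
  by under eq_esum do rewrite sqr_vlen.
by under eq_esum do rewrite sqr_vlen.
Qed.

(** Brings finiteness into the form in which Cauchy-Schwarz and [tri_bounded] take their bounds. *)
Lemma l2sq_sqrt l a : (l2sq l a < +oo)%E ->
  exists2 A : R, 0 <= A & (l2sq l a <= (A ^+ 2)%:E)%E.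
Proof.
move=> aoo; exists (Num.sqrt (fine (l2sq l a))); first exact: sqrtr_ge0.
by rewrite sqr_sqrtr ?fine_ge0 ?l2sq_ge0// fineK// ge0_fin_numE// l2sq_ge0.
Qed.

Lemma rsummable_vdot l a b : (l2sq l a < +oo)%E -> (l2sq l b < +oo)%E ->
  rsummable (Lam3 l) (fun k => vdot (a k) (b k)).
Proof.
move=> /l2sq_sqrt[A A0 aA] /l2sq_sqrt[B B0 bB].
apply: le_lt_trans (ltry (3 * (A * B))); exact: esum_vdot_le.
Qed.

Lemma pairing_le l a b (A B : R) : 0 <= A -> 0 <= B ->
  (l2sq l a <= (A ^+ 2)%:E)%E -> (l2sq l b <= (B ^+ 2)%:E)%E ->
  `|pairing l a b| <= 3 * (A * B).
Proof.
move=> A0 B0 aA bB; have le := esum_vdot_le A0 B0 aA bB.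
have s : rsummable (Lam3 l) (fun k => vdot (a k) (b k)).
  by apply: le_lt_trans le _; exact: ltry.
apply: le_trans (ler_abs_rsum s) _.
by rewrite -lee_fin fineK// ge0_fin_numE// esum_ge0.
Qed.

(** In [tri_bounded] the coefficients live on all row vectors, while fields are controlled on the
    lattice only; hence the extension by zero. *)
Lemma esum_ext0 l (g : 'rV[R]_3 -> R) (M : R) :
  (\esum_(k in Lam3 l) (g k ^+ 2)%:E <= M%:E)%E ->
  (\esum_(k in [set: 'rV[R]_3]) ((if k \in Lam3 l then g k else 0) ^+ 2)%:E <= M%:E)%E.
Proof.
rewrite esum_mkcond; apply: le_trans; apply: le_esum => k _.
by case: ifP => //; rewrite expr0n.
Qed.

(** By [triple_le] the terms are dominated by the form on triads with coefficients [|a|], [|k| |b|]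
    and [|c|], all three of them square summable. *)
Lemma rsummable_triple l m a b c : 1 < l -> (1 <= m)%N ->
  inV l m a -> inV l m b -> inV l m c -> rsummable (triads l) (triple a b c).
Proof.
move=> l1 m1 aV bV cV; have [K K0 KP] := tri_bounded_triads l1.
have [A A0 aA] := l2sq_sqrt (inV_l2sq l1 aV).
have [D D0 cD] := l2sq_sqrt (inV_l2sq l1 cV).
have [B B0 bB] : exists2 B : R, 0 <= B &
    (\esum_(k in Lam3 l) ((klen k * vlen (b k)) ^+ 2)%:E <= (B ^+ 2)%:E)%E.
  case: bV => _ b0 _ boo; exists (Num.sqrt (fine (hm_sq l m b))); first exact: sqrtr_ge0.
  have h0 : (0 <= hm_sq l m b)%E.
    apply: esum_ge0 => k _; rewrite lee_fin mulr_ge0 ?exprn_ge0 ?vsq_ge0//.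
    by apply: sumr_ge0 => j _; exact: sqr_ge0.
  rewrite sqr_sqrtr ?fine_ge0// fineK ?ge0_fin_numE//; exact: grad_l2sq_le_hm_sq.
have ext0 (g : 'rV[R]_3 -> R) k : 0 <= g k -> 0 <= if k \in Lam3 l then g k else 0.
  by case: ifP.
have := KP (fun k => if k \in Lam3 l then vlen (a k) else 0)
  (fun k => if k \in Lam3 l then klen k * vlen (b k) else 0)
  (fun k => if k \in Lam3 l then vlen (c k) else 0) A B D.
move=> /(_ (fun k => ext0 (fun k => vlen (a k)) k (vlen_ge0 _)))
  /(_ (fun k => ext0 (fun k => klen k * vlen (b k)) k (mulr_ge0 (klen_ge0 _) (vlen_ge0 _))))
  /(_ (fun k => ext0 (fun k => vlen (c k)) k (vlen_ge0 _)) A0 B0 D0).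
have aA' : (\esum_(k in Lam3 l) (vlen (a k) ^+ 2)%:E <= (A ^+ 2)%:E)%E.
  by under eq_esum do rewrite sqr_vlen.
have cD' : (\esum_(k in Lam3 l) (vlen (c k) ^+ 2)%:E <= (D ^+ 2)%:E)%E.
  by under eq_esum do rewrite sqr_vlen.
move=> /(_ (esum_ext0 aA') (esum_ext0 bB) (esum_ext0 cD')) le.
apply: (@le_lt_trans _ _ (9%:E * (K * A * B * D)%:E)%E); last by rewrite -EFinM ltry.
apply: le_trans (lee_wpmul2l _ le); last by rewrite lee_fin.
rewrite -esumZl// => [|t]; last first.
  rewrite lee_fin; do ?apply: mulr_ge0; case: ifP => // _; rewrite ?vlen_ge0//.
  by rewrite mulr_ge0 ?klen_ge0 ?vlen_ge0.
apply: le_esum => -[k [p q]] [/= Lk [Lp Lq _]].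
rewrite !mem_set// -EFinM lee_fin; exact: triple_le.
Qed.

(** A complex factor mixes the real and imaginary sums of which [csum] is made, so both must
    converge. *)
Lemma Re_csumM (T : choiceType) (D : set T) (f : T -> C) (w : C) :
  rsummable D (fun x => Re (f x)) -> rsummable D (fun x => Im (f x)) ->
  Re (csum D f * w) = rsum D (fun x => Re (f x * w)).
Proof.
move=> sr si.
have -> : rsum D (fun x => Re (f x * w)) =
    rsum D (fun x => Re w * Re (f x) + - (Im w * Im (f x))).
  by apply: eq_rsum => x _; rewrite ReM mulrC [X in _ - X]mulrC.
rewrite rsumD; [|exact: rsummableZ|by apply: rsummableN; exact: rsummableZ].
by rewrite rsumN (rsumZ _ sr) (rsumZ _ si) ReM /= mulrC [X in _ - X]mulrC.
Qed.

(** For fixed [k] each of [p] and [q] determines the pair, so [x y <= x^2 + y^2] bounds the sum by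
    two l^2 sums. The convolutions in [adv] are thus genuine sums rather than default values of
    [fine]. *)
Lemma rsummable_fiber_product l m a b k : 1 < l -> (1 <= m)%N -> inV l m a -> inV l m b ->
  (\esum_(pq in fiber l k) (vlen (a pq.1) * (klen pq.2 * vlen (b pq.2)))%:E < +oo)%E.
Proof.
move=> l1 m1 aV bV.
have aoo := inV_l2sq l1 aV.
have boo : (\esum_(k in Lam3 l) ((klen k * vlen (b k)) ^+ 2)%:E < +oo)%E.
  by case: bV => _ b0 _; apply: le_lt_trans; exact: grad_l2sq_le_hm_sq.
apply: le_lt_trans (lte_add_pinfty aoo boo).
apply: (@le_trans _ _ (\esum_(pq in fiber l k) (vsq (a pq.1))%:E +
    \esum_(pq in fiber l k) ((klen pq.2 * vlen (b pq.2)) ^+ 2)%:E)%E).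
  rewrite -esumD; try by move=> pq _; rewrite lee_fin ?vsq_ge0 ?sqr_ge0.
  apply: le_esum => pq _; rewrite -EFinD lee_fin -sqr_vlen.
  move: (vlen _) (klen _ * _) => x y.
  have := sqr_ge0 (x - y); have := sqr_ge0 (x + y); rewrite !expr2; lra.
apply: leeD.
  apply: (@esum_le_bij _ _ _ _ (Lam3 l) fst (fun j => (vsq (a j))%:E)) => [|pq []//|j _].
    move=> [p q] [p' q']; rewrite !inE /= => -[_ _ kE] [_ _ kE'] pp.
    have {}pp : p = p' := pp; subst p'.
    by move: kE'; rewrite -kE => /addrI/= ->.
  by rewrite lee_fin vsq_ge0.
apply: (@esum_le_bij _ _ _ _ (Lam3 l) snd
  (fun j => ((klen j * vlen (b j)) ^+ 2)%:E)) => [|pq []//|j _].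
  move=> [p q] [p' q']; rewrite !inE /= => -[_ _ kE] [_ _ kE'] qq.
  have {}qq : q = q' := qq; subst q'.
  by move: kE'; rewrite -kE => /addIr/= ->.
by rewrite lee_fin sqr_ge0.
Qed.

Lemma vdot_adv l m a b c k : 1 < l -> (1 <= m)%N -> inV l m a -> inV l m b ->
  vdot (adv l a b k) (c k) = rsum (fiber l k) (fun pq => triple a b c (k, pq)).
Proof.
move=> l1 m1 aV bV; have foo := rsummable_fiber_product k l1 m1 aV bV.
pose f i j (pq : 'rV[R]_3 * 'rV[R]_3) : C :=
  a pq.1 ord0 j * ('i * (pq.2 ord0 j)%:C * b pq.2 ord0 i).
have fr i j : rsummable (fiber l k) (fun pq => Re (f i j pq)).
  apply: rsummable_le foo => pq _; apply: le_trans (Re_le_normc _) _; exact: product_le.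
have fi i j : rsummable (fiber l k) (fun pq => Im (f i j pq)).
  apply: rsummable_le foo => pq _; apply: le_trans (Im_le_normc _) _; exact: product_le.
have fw i j (w : C) : rsummable (fiber l k) (fun pq => Re (f i j pq * w)).
  rewrite [X in summable _ X](_ : _ =
    fun pq => (Re w * Re (f i j pq) + - (Im w * Im (f i j pq)))%:E).
    by apply: rsummableD; [|apply: rsummableN]; exact: rsummableZ.
  by apply/funext => pq; rewrite ReM; congr (_%:E); ring.
pose g i j pq := Re (f i j pq * (c k ord0 i)^*).
have gs i j : rsummable (fiber l k) (g i j) by exact: fw.
have -> : rsum (fiber l k) (fun pq => triple a b c (k, pq)) =
    rsum (fiber l k) (fun pq => \sum_(i < 3) \sum_(j < 3) g i j pq).
  apply: eq_rsum => pq _; rewrite /triple Re_sum; apply: eq_bigr => i _.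
  by rewrite Re_sum.
rewrite (@rsum_sum _ _ (fiber l k) _ _ (fun i pq => \sum_(j < 3) g i j pq)); last first.
  by move=> i; apply: (@rsummable_sum _ _ (fiber l k) _ _ (g i)).
rewrite /vdot Re_sum; apply: eq_bigr => i _.
rewrite (@rsum_sum _ _ (fiber l k) _ _ (g i))//.
rewrite mxE mulr_suml Re_sum; apply: eq_bigr => j _.
by rewrite /conv Re_csumM; [|exact: fr|exact: fi].
Qed.

(** The Hermitian product equals [- P k] times the conjugate of [div a k]; the sign comes from
    conjugating ['i]. *)
Lemma vdot_grad (P : 'rV[R]_3 -> C) a k : div a k = 0 -> vdot (grad P k) (a k) = 0.
Proof.
rewrite /div => da.
have -> : vdot (grad P k) (a k) =
    Re (- (P k * (\sum_(j < 3) 'i * (k ord0 j)%:C * a k ord0 j)^*)).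
  rewrite /vdot rmorph_sum mulr_sumr -sumrN; congr Re; apply: eq_bigr => j _.
  rewrite mxE !rmorphM/=.
  by move: (P k) (a k ord0 j) => [x y] [x' y'] /=; apply/eqP; rewrite eq_complex/=;
    apply/andP; split; apply/eqP; ring.
by rewrite da rmorph0 mulr0 oppr0.
Qed.

(** The involution [e] permutes the triads, so the pointwise [triple_skew] sums up by reindexing. *)
Lemma rsum_triple_skew l a b c : real_vfield l a -> (forall k, Lam3 l k -> div a k = 0) ->
  rsum (triads l) (triple a b c) = - rsum (triads l) (triple a c b).
Proof.
move=> ra da; pose e (t : 'rV[R]_3 * ('rV[R]_3 * 'rV[R]_3)) := (t.2.2, (- t.2.1, t.1)).
have eK t : e (e t) = t by case: t => k [p q]; rewrite /e/= opprK.
have et t : triads l t -> triads l (e t).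
  case: t => k [p q] [/= Lk [Lp Lq kE]]; split=> //=; split=> //=.
    exact: Lam3_opp.
  by rewrite -kE addKr.
have eb : set_bij (triads l) (triads l) e.
  split=> [t /et //|t t' _ _ E|t tl]; first by rewrite -[t]eK E eK.
  by exists (e t); [exact: et|exact: eK].
rewrite [X in - X](rsum_reindex _ eb) -rsumN; apply: eq_rsum => -[k [p q]] [/= Lk [Lp Lq kE]].
exact: (triple_skew _ _ ra da Lp kE).
Qed.

Lemma pairing_derivative_eq0 l m a a' b b' (P : 'rV[R]_3 -> C) : 1 < l -> (1 <= m)%N ->
  inV l m a -> inV l m a' -> inV l m b -> inV l m b' ->
  (forall k, Lam3 l k -> k != 0 -> a' k + adv l a a k = - grad P k) ->
  (forall k, Lam3 l k -> k != 0 -> b' k + adv l a b k - adv l b a k = 0) ->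
  pairing l a' b + pairing l a b' = 0.
Proof.
move=> l1 m1 aV a'V bV b'V eqa eqb.
have fin := fun c => @inV_l2sq l m c l1.
(* The first two terms cancel by skewness with transporting field [a]; the third is skew with
   itself, hence sums to zero. The pressure contributes nothing. *)
pose F t := - triple a a b t + - triple a b a t + triple b a a t.
have sT x y z : inV l m x -> inV l m y -> inV l m z -> rsummable (triads l) (triple x y z).
  exact: rsummable_triple.
have sN x y z : inV l m x -> inV l m y -> inV l m z ->
    rsummable (triads l) (fun t => - triple x y z t).
  by move=> *; apply/rsummableN/sT.
have sF : rsummable (triads l) F.
  by apply: rsummableD; [apply: rsummableD; exact: sN|exact: sT].
have fib x y z k : inV l m x -> inV l m y -> inV l m z -> Lam3 l k ->
    rsummable (fiber l k) (fun pq => triple x y z (k, pq)).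
  move=> xV yV zV; apply: (rsummable_fiber (F := fun k pq => triple x y z (k, pq))).
  by rewrite [X in summable _ X](_ : _ = fun t => (triple x y z t)%:E);
    [exact: sT|apply/funext => -[]].
have E k : Lam3 l k -> vdot (a' k) (b k) + vdot (a k) (b' k) =
    rsum (fiber l k) (fun pq => F (k, pq)).
  move=> Lk; rewrite /F !rsumD ?rsumN; last 4 first.
  - by apply: rsummableN; exact: fib.
  - by apply: rsummableN; exact: fib.
  - by apply: rsummableD; apply: rsummableN; exact: fib.
  - exact: fib.
  rewrite -!(vdot_adv _ _ l1 m1)//.
  (* The equations say nothing at [k = 0], but both fields vanish there and so do both sides. *)
  have [-> |k0] := eqVneq k 0.
    case: aV bV => _ -> _ _ [_ -> _ _].
    by rewrite !(vdotC _ 0) !vdot0l !oppr0 !addr0.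
  have a'E : a' k = - grad P k - adv l a a k by rewrite -(eqa k Lk k0) addrK.
  have b'E : b' k = adv l b a k - adv l a b k.
    by apply/eqP; rewrite -subr_eq0 opprB addrA eqb.
  have [_ _ db _] := bV.
  rewrite a'E b'E vdotDl !vdotNl vdot_grad ?db// oppr0 add0r vdotDr vdotNr.
  by rewrite !(vdotC (a k)); ring.
rewrite /pairing -rsumD; try by apply: rsummable_vdot; exact: fin.
rewrite (eq_rsum E) (rsum_rsum (F := fun k pq => F (k, pq))); last first.
  by rewrite [X in summable _ X](_ : _ = fun t => (F t)%:E)//; apply/funext => -[].
rewrite (_ : rsum _ _ = rsum (triads l) F); last by apply: eq_rsum => -[].
rewrite rsumD ?rsumD ?rsumN; last 4 first.
- exact: sN.
- exact: sN.
- by apply: rsummableD; exact: sN.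
- exact: sT.
have [[ra _ da _] [rb _ db _]] := (aV, bV).
have h1 := rsum_triple_skew a b ra da; have h2 := rsum_triple_skew a a rb db.
move: h1 h2; lra.
Qed.

(** Reality makes the imaginary part of the summand odd under [k -> - k], so its sum equals its own
    opposite. *)
Lemma innerE l a b : real_vfield l a -> real_vfield l b -> inner l a b = (pairing l a b)%:C.
Proof.
move=> ra rb; rewrite /inner /csum; congr (_ +i* _).
set g := fun k => _; have gN k : Lam3 l k -> g (- k) = - g k.
  move=> Lk; rewrite /g; under eq_bigr do rewrite ra// rb// -rmorphM.
  by rewrite -rmorph_sum; case: (\sum_(i < 3) _).
have eb : set_bij (Lam3 l) (Lam3 l) (fun k => - k).
  split=> [k /Lam3_opp//|k k' _ _ /oppr_inj//|k Lk].
  by exists (- k); [exact: Lam3_opp|rewrite opprK].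
have : rsum (Lam3 l) g = - rsum (Lam3 l) g.
  by rewrite {1}(rsum_reindex _ eb) -rsumN; exact: eq_rsum.
lra.
Qed.

End Energy.

(** * Constancy in time *)

Section Time.
Variable R : realType.
Local Notation C := R[i].
Local Notation field := ('rV[R]_3 -> 'rV[C]_3).
Implicit Types (l s t : R) (a b c : field) (m : nat) (T : \bar R).

Lemma flat_constant (f : R -> R) :
  (forall x e, 0 < e -> exists2 d : R, 0 < d &
     forall y, `|y - x| < d -> `|f y - f x| <= e * `|y - x|) ->
  forall x y, f x = f y.
Proof.
move=> flat x y; apply: is_derive_0_is_cst => {x y} z.
have lim0 : h^-1 *: ((f \o shift z) (h *: (1 : R)) - f z) @[h --> 0^'] --> (0 : R).
  apply/cvgrPdist_le => e e0; have [d d0 dP] := flat z e e0.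
  near=> h; rewrite sub0r normrN normrZ normfV /= [h *: 1]mulr1.
  have h0 : h != 0 by near: h; exact: nbhs_dnbhs_neq.
  rewrite mulrC ler_pdivrMr ?normr_gt0//.
  have hE : h = h + z - z by rewrite addrK.
  rewrite [X in _ * `|X|]hE; apply: dP; rewrite -hE.
  near: h; apply: dnbhs0_lt; exact: d0.
by split; [exact: cvgP lim0|exact: cvg_lim lim0].
Unshelve. all: by end_near.
Qed.

Lemma locally_flat_constant T (f : R -> R) :
  (forall t e, inI T t -> 0 < e -> exists2 d : R, 0 < d &
     forall s, inI T (t + s) -> `|s| < d -> `|f (t + s) - f t| <= e * `|s|) ->
  forall t1 t2, inI T t1 -> inI T t2 -> f t1 = f t2.
Proof.
move=> flat; suff le t1 t2 : inI T t1 -> inI T t2 -> t1 <= t2 -> f t1 = f t2.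
  by move=> t1 t2 T1 T2; have [/le ->//|/ltW/le ->] := leP t1 t2.
(* Clamping to [[t1, t2]] is 1-Lipschitz, so [f \o cl] is flat on the whole line, even at the
   endpoints, where flatness of [f] may be one-sided. *)
move=> T1 T2 t12; pose cl x := Num.max t1 (Num.min x t2).
have clI x : inI T (cl x).
  case: T1 T2 => [t10 _] [_ t2T]; split; first by rewrite le_max t10.
  by apply: le_lt_trans t2T; rewrite lee_fin ge_max t12 ge_min lexx orbT.
have cl_lip x y : `|cl y - cl x| <= `|y - x|.
  rewrite /cl /Num.max /Num.min.
  have := ler_norm (y - x); have := ler_norm (x - y); rewrite (distrC x y).
  by rewrite ler_norml; do 4?case: ifPn; rewrite -?leNgt; lra.
have cl1 : cl t1 = t1 by rewrite /cl /Num.max /Num.min; do 2?case: ifPn; rewrite -?leNgt; lra.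
have cl2 : cl t2 = t2 by rewrite /cl /Num.max /Num.min; do 2?case: ifPn; rewrite -?leNgt; lra.
rewrite -cl1 -[in RHS]cl2; apply: (@flat_constant (f \o cl)) => x e e0.
have [d d0 dP] := flat _ e (clI x) e0; exists d => // y yx /=.
have clE : cl y = cl x + (cl y - cl x) by rewrite addrC subrK.
rewrite {1}clE; apply: le_trans (dP _ _ _) _; first by rewrite -clE.
  exact: le_lt_trans (cl_lip x y) yx.
by rewrite ler_pM2l// cl_lip.
Qed.

(** Extracts an explicit radius from the [within] filter and the topology of the extended reals. *)
Lemma C1V_quotient_near l m T (u u' : R -> field) t (eta : R) :
  C1V l m T u u' -> inI T t -> 0 < eta ->
  exists2 d : R, 0 < d & forall s, s != 0 -> inI T (t + s) -> `|s| < d ->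
    (hm_sq l m (fun k => (s^-1)%:C *: (u (t + s) k - u t k) - u' t k)%R <= eta%:E)%E.
Proof.
move=> [_ du _] tT eta0.
have eN : nbhs (0%:E : \bar R) [set y | (y < eta%:E)%E].
  by have := @nbhs_open_ereal_lt R 0 (fun=> eta) eta0.
have /nbhs_ballP[d d0 dP] := du t tT _ eN.
exists d => // s s0 sT sd; apply: ltW; apply: dP => //.
by rewrite /ball/= sub0r normrN.
Qed.

(** The terms [x1], [x2] contribute [6 N eta]. The other four add up to at most [12 N^2], and
    [|s| N <= eta] turns their share into [12 N eta]. *)
Lemma bilinear_remainder (eta N s x1 x2 x3 x4 x5 x6 : R) :
  0 <= eta -> eta <= 1 -> 1 <= N -> `|s| * N <= eta ->
  `|x1| <= 3 * (eta * N) -> `|x2| <= 3 * (N * eta) -> `|x3| <= 3 * (N * N) ->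
  `|x4| <= 3 * (eta * N) -> `|x5| <= 3 * (N * eta) -> `|x6| <= 3 * (eta * eta) ->
  `|x1 + x2 + s * (x3 + x4 + x5 + x6)| <= 18 * N * eta.
Proof.
move=> e0 e1 N1 sN h1 h2 h3 h4 h5 h6.
have eN : eta * eta <= N * N by nra.
have eN' : eta * N <= N * N by nra.
have big : `|x3 + x4 + x5 + x6| <= 12 * (N * N).
  apply: le_trans (ler_normD _ _) _; have := ler_normD (x3 + x4) x5; have := ler_normD x3 x4.
  by rewrite (mulrC N eta) in h5 *; lra.
apply: le_trans (ler_normD _ _) _; have := ler_normD x1 x2; rewrite normrM.
have s1 : `|s| * `|x3 + x4 + x5 + x6| <= `|s| * (12 * (N * N)) by rewrite ler_wpM2l.
have s2 : `|s| * (12 * (N * N)) <= 12 * (N * eta).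
  have -> : `|s| * (12 * (N * N)) = 12 * (N * (`|s| * N)) by ring.
  by rewrite ler_wpM2l// ler_wpM2l//; lra.
by rewrite (mulrC eta N) in h1 *; lra.
Qed.

(** A quantitative product rule: the first order term vanishes by hypothesis, and the remainders of
    the two difference quotients are small in l^2. *)
Lemma pairing_flat l m T (u u' h h' : R -> field) t (e : R) : 1 < l ->
  C1V l m T u u' -> C1V l m T h h' -> inI T t -> 0 < e ->
  pairing l (u' t) (h t) + pairing l (u t) (h' t) = 0 ->
  exists2 d : R, 0 < d & forall s, inI T (t + s) -> `|s| < d ->
    `|pairing l (u (t + s)) (h (t + s)) - pairing l (u t) (h t)| <= e * `|s|.
Proof.
move=> l1 uC hC tT e0 dP0.
have [[uV u'V] [hV h'V]] : (inV l m (u t) /\ inV l m (u' t)) /\ (inV l m (h t) /\ inV l m (h' t)).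
  by case: uC hC => uV _ _ [hV _ _]; split; [exact: uV|exact: hV].
have [A A0 uA] := l2sq_sqrt (inV_l2sq l1 uV).
have [A' A'0 u'A'] := l2sq_sqrt (inV_l2sq l1 u'V).
have [B B0 hB] := l2sq_sqrt (inV_l2sq l1 hV).
have [B' B'0 h'B'] := l2sq_sqrt (inV_l2sq l1 h'V).
(* One number above [1] and above all four l^2 norms at time [t]. *)
pose N := 1 + A + A' + B + B'.
have N1 : 1 <= N by rewrite /N; lra.
have leN a X : 0 <= X -> X <= N -> (l2sq l a <= (X ^+ 2)%:E)%E -> (l2sq l a <= (N ^+ 2)%:E)%E.
  move=> X0 XN /le_trans -> //; rewrite lee_fin ler_pXn2r// nnegrE; lra.
have {}uA : (l2sq l (u t) <= (N ^+ 2)%:E)%E by apply: leN uA => //; rewrite /N; lra.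
have {}u'A' : (l2sq l (u' t) <= (N ^+ 2)%:E)%E by apply: leN u'A' => //; rewrite /N; lra.
have {}hB : (l2sq l (h t) <= (N ^+ 2)%:E)%E by apply: leN hB => //; rewrite /N; lra.
have {}h'B' : (l2sq l (h' t) <= (N ^+ 2)%:E)%E by apply: leN h'B' => //; rewrite /N; lra.
have N0 : 0 < N by lra.
(* The value [e / (18 * N)] matches the constant of [bilinear_remainder]; it is squared below
   because [hm_sq] is a squared norm. *)
pose eta := Num.min 1 (e / (18 * N)).
have eta0 : 0 < eta by rewrite lt_min ltr01 divr_gt0// mulr_gt0.
have eta1 : eta <= 1 by rewrite ge_min lexx.
have etae : 18 * N * eta <= e.
  by rewrite mulrC -ler_pdivlMr ?mulr_gt0// ge_min lexx orbT.
have eta20 : 0 < eta ^+ 2 by rewrite exprn_gt0.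
have [d1 d10 d1P] := C1V_quotient_near uC tT eta20.
have [d2 d20 d2P] := C1V_quotient_near hC tT eta20.
exists (Num.min (Num.min d1 d2) (eta / N)); first by rewrite !lt_min d10 d20 divr_gt0.
move=> s sT; rewrite !lt_min -andbA => /and3P[sd1 sd2 sN].
have [->|s0] := eqVneq s 0; first by rewrite addr0 subrr normr0 mulr0.
have {}sN : `|s| * N <= eta by rewrite -ler_pdivlMr// ltW.
have z0 a : inV l m a -> a 0 = 0 by case.
have [uVs hVs] : inV l m (u (t + s)) /\ inV l m (h (t + s)).
  by case: uC hC => /(_ _ sT)[? _] _ _ [/(_ _ sT)[? _] _ _].
have {d1P sd1}Dh := d1P s s0 sT sd1; have {d2P sd2}Eh := d2P s s0 sT sd2.
(* [D] and [E] are the errors of the difference quotients of [u] and [h]. *)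
set D := (X in hm_sq l m X) in Dh; set E := (X in hm_sq l m X) in Eh.
have D0 : D 0 = 0 by rewrite /D !z0// !subr0 scaler0.
have E0 : E 0 = 0 by rewrite /E !z0// !subr0 scaler0.
have Dl := le_trans (l2sq_le_hm_sq m l1 D0) Dh.
have El := le_trans (l2sq_le_hm_sq m l1 E0) Eh.
have fin a X : (l2sq l a <= (X ^+ 2)%:E)%E -> (l2sq l a < +oo)%E.
  by move=> /le_lt_trans -> //; exact: ltry.
have stepE (x y x' z : 'rV[C]_3) : z = (s^-1)%:C *: (y - x) - x' -> y = x + s%:C *: (x' + z).
  move=> ->; rewrite addrCA subrr addr0 scalerA -rmorphM divff// scale1r addrC subrK//.
have uE k : u (t + s) k = u t k + s%:C *: (u' t k + D k) by exact: stepE.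
have hE k : h (t + s) k = h t k + s%:C *: (h' t k + E k) by exact: stepE.
have expand : pairing l (u (t + s)) (h (t + s)) = pairing l (u t) (h t) +
   s * (pairing l (u' t) (h t) + pairing l (u t) (h' t)) +
   s * (pairing l D (h t) + pairing l (u t) E +
     s * (pairing l (u' t) (h' t) + pairing l D (h' t) + pairing l (u' t) E + pairing l D E)).
  (* Summability travels together with the value, so that the long expansion is summed term by
     term. *)
  pose sums f (v : R) := rsummable (Lam3 l) f /\ rsum (Lam3 l) f = v.
  have sumsD f g v w : sums f v -> sums g w -> sums (fun k => f k + g k) (v + w).
    by move=> [sf <-] [sg <-]; split; [exact: rsummableD|exact: rsumD].
  have sumsZ f v : sums f v -> sums (fun k => s * f k) (s * v).
    by move=> [sf <-]; split; [exact: rsummableZ|exact: rsumZ].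
  have sums_vdot a b X Y : (l2sq l a <= (X ^+ 2)%:E)%E -> (l2sq l b <= (Y ^+ 2)%:E)%E ->
      sums (fun k => vdot (a k) (b k)) (pairing l a b).
    by move=> /fin aX /fin bY; split=> //; exact: rsummable_vdot.
  rewrite {1}/pairing (_ : rsum _ _ = rsum (Lam3 l) (fun k => vdot (u t k) (h t k) +
    s * (vdot (u' t k) (h t k) + vdot (u t k) (h' t k)) +
    s * (vdot (D k) (h t k) + vdot (u t k) (E k) +
      s * (vdot (u' t k) (h' t k) + vdot (D k) (h' t k) +
        vdot (u' t k) (E k) + vdot (D k) (E k))))); last first.
    by apply: eq_rsum => k _; rewrite uE hE !(vdotDl, vdotDr, vdotZl, vdotZr); ring.
  apply: (proj2 (_ : sums _ _)).
  have UH := sums_vdot _ _ _ _ uA hB; have U'H := sums_vdot _ _ _ _ u'A' hB.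
  have UH' := sums_vdot _ _ _ _ uA h'B'; have DH := sums_vdot _ _ _ _ Dl hB.
  have UE := sums_vdot _ _ _ _ uA El; have U'H' := sums_vdot _ _ _ _ u'A' h'B'.
  have DH' := sums_vdot _ _ _ _ Dl h'B'; have U'E := sums_vdot _ _ _ _ u'A' El.
  have DE := sums_vdot _ _ _ _ Dl El.
  exact: (sumsD _ _ _ _ (sumsD _ _ _ _ UH (sumsZ _ _ (sumsD _ _ _ _ U'H UH')))
    (sumsZ _ _ (sumsD _ _ _ _ (sumsD _ _ _ _ DH UE) (sumsZ _ _
      (sumsD _ _ _ _ (sumsD _ _ _ _ (sumsD _ _ _ _ U'H' DH') U'E) DE))))).
rewrite expand dP0 mulr0 addr0 addrAC subrr add0r normrM mulrC ler_pM2r ?normr_gt0//.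
apply: le_trans etae; apply: bilinear_remainder => //; try exact: ltW.
all: by apply: pairing_le => //; exact: ltW.
Qed.

End Time.

Theorem theorem6 (R : realType) (l : R) (m : nat) (T : \bar R)
    (u u' h h' : R -> 'rV[R]_3 -> 'rV[R[i]]_3) :
  lambda_ok l -> (1 <= m)%N -> (0 < T)%E ->
  euler_strong l m T u u' ->
  C1V l m T h h' ->
  (forall t, inI T t -> forall k, Lam3 l k -> k != 0 ->
     h' t k + adv l (u t) (h t) k - adv l (h t) (u t) k = 0) ->
  forall t1 t2, inI T t1 -> inI T t2 -> inner l (u t1) (h t1) = inner l (u t2) (h t2).
Proof.
move=> /lambda_gt1 l1 m1 _ [uC [p [_ euler]]] hC transport t1 t2 T1 T2.
have V t : inI T t -> [/\ inV l m (u t), inV l m (u' t), inV l m (h t) & inV l m (h' t)].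
  by move=> tT; case: uC hC => /(_ t tT)[? ?] _ _ [/(_ t tT)[? ?] _ _].
have real t : inI T t -> real_vfield l (u t) /\ real_vfield l (h t).
  by move=> /V[[? _ _ _] _ [? _ _ _] _].
have [[ru1 rh1] [ru2 rh2]] := (real _ T1, real _ T2).
rewrite !innerE//; congr (_%:C).
apply: (locally_flat_constant _ T1 T2 (f := fun t => pairing l (u t) (h t))) => t e tT e0.
apply: (pairing_flat l1 uC hC tT e0); have [uV u'V hV h'V] := V t tT.
exact: (pairing_derivative_eq0 l1 m1 uV u'V hV h'V (euler t tT) (transport t tT)).
Qed.
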